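(* Let $F$ be a complete locally convex space, $\ell\in\mathbb{N}_0\cup\{\infty\}$, $d\in\mathbb{N}$, and let $R\subseteq\mathbb{R}^d$ be a convex subset with dense interior. Then $$C^\ell(R,F)\;\cong\;F\,\widetilde{\otimes}_\varepsilon\,C^\ell(R,\mathbb{R})$$ as a locally convex space.
   Context: $\mathbb{N}=\{1,2,\ldots\}$, $\mathbb{N}_0=\mathbb{N}\cup\{0\}$. ''Locally convex space'' means a real, Hausdorff locally convex topological vector space; it is complete if every Cauchy net converges. ''$R$ has dense interior'' means that the interior $R^0$ of $R$ in $\mathbb{R}^d$ is dense in $R$. For such $R$, $C^\ell(R,F)$ is the space of continuous maps $\gamma\colon R\to F$ such that $\gamma|_{R^0}$ is $C^\ell$ (continuous partial derivatives $\partial^\alpha$ for $|\alpha|\le\ell$) and each $\partial^\alpha(\gamma|_{R^0})$, $|\alpha|\le\ell$, extends to a (necessarily unique) continuous map $\partial^\alpha\gamma\colon R\to F$. It carries the compact-open $C^\ell$-topology: the initial topology with respect to the maps $\gamma\mapsto\partial^\alpha\gamma\in C(R,F)$, $|\alpha|\le\ell$, with the compact-open topology on $C(R,F)$. $\widetilde{\otimes}_\varepsilon$ denotes the completed injective tensor product (the completion of the algebraic tensor product in the $\varepsilon$-topology, i.e. the topology induced by the embedding $E_1\otimes E_2\to\mathcal{L}((E_1)'_\tau,E_2)$, $x\otimes y\mapsto(\lambda\mapsto\lambda(x)y)$, where $(E_1)'_\tau$ is the dual with the Mackey topology and the operator space has the topology of uniform convergence on equicontinuous subsets of $E_1'$).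 *)

(* Defs.v *)
From HB Require Import structures.
From mathcomp Require Import all_boot all_order all_algebra.
From mathcomp Require Import generic_quotient finmap.
From mathcomp Require Import all_classical all_reals all_analysis.

Set Implicit Arguments.
Unset Strict Implicit.
Unset Printing Implicit Defensive.
Import Order.TTheory GRing.Theory Num.Theory.
Import numFieldNormedType.Exports.
Local Open Scope classical_set_scope.
Local Open Scope ring_scope.
Local Open Scope quotient_scope.

(* Real Hausdorff locally convex spaces. The mixin of [tvsType] does not relate
   its uniform structure to the group structure; [lcs_entourageE] imposes the
   usual (unique translation-invariant) uniformity, so that [cauchy],
   [equicontinuous] and [{family _, _ -> _}] have their standard meaning. *)
HB.mixin Record Tvs_isLcs (R : numDomainType) E & Tvs R E := {
  lcs_hausdorff : hausdorff_space E ;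
  lcs_entourageE : @entourage E =
    filter_from (nbhs (0 : E)) (fun U => [set xy : E * E | U (xy.1 - xy.2)])
}.

#[short(type="lcsType")]
HB.structure Definition Lcs (R : numDomainType) := {E of Tvs R E & Tvs_isLcs R E}.

Section regular_lcs.
Variable R : realType.

Let regular_hausdorff : hausdorff_space R^o.
Proof. exact: (@norm_hausdorff R R^o). Qed.

Let regular_entourage : @entourage R^o =
  filter_from (nbhs (0 : R^o)) (fun U => [set xy : R^o * R^o | U (xy.1 - xy.2)]).
Proof.
rewrite -entourage_ballE; apply/seteqP; split=> E /=.
  case=> e /= e0 sE; exists (ball (0 : R^o) e); first exact: nbhsx_ballx.
  move=> [x y] /=; rewrite -ball_normE /ball_ /= sub0r normrN => xy.
  by apply: sE; rewrite /= -ball_normE.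
case=> U /nbhs_ballP [e /= e0 eU] UE; exists e => //= -[x y] /=.
rewrite -ball_normE /ball_ /= => xy; apply: UE => /=; apply: eU.
by rewrite -ball_normE /ball_ /= sub0r normrN.
Qed.

HB.instance Definition _ :=
  Tvs_isLcs.Build R R^o regular_hausdorff regular_entourage.
End regular_lcs.

Section lcs_theory.
Context {R : realType} {E : lcsType R}.
Implicit Types (x y : E) (U V : set E).

Lemma lcs_nbhs0P x U : nbhs x U <-> nbhs 0 [set u | U (u + x)].
Proof.
split=> [Ux|U0].
  have := @nbhsB R E U x (- x) Ux; rewrite addNr; apply: filterS => _ [z Uz <-] /=.
  by rewrite addrC addrA subrr add0r.
have := @nbhsT R E _ x U0; apply: filterS => _ [z Uz <-] /=.
by rewrite addrC.
Qed.

Lemma lcs_split U : nbhs 0 U ->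
  exists2 V, nbhs 0 V & forall x y, V x -> V y -> U (x + y).
Proof.
move=> U0; have := @add_continuous E (0, 0) U; rewrite /= addr0 => /(_ U0).
case=> -[A B] /= [A0 B0] AB; exists (A `&` B); first exact: filterI.
by move=> x y [Ax _] [_ By]; exact: (AB (x, y)).
Qed.

Lemma lcs_cvg_lin T (G : set_system T) {FG : Filter G} (f g : T -> E)
    (a : R) x y : f @ G --> x -> g @ G --> y ->
  (fun t => a *: f t + g t) @ G --> a *: x + y.
Proof.
move=> fx gy.
have af : (fun t => a *: f t) @ G --> a *: x.
  have := @continuous2_cvg T R^o E E G FG (fun=> a) f (fun (x : R^o) (y : E) => x *: y) a x (@scale_continuous R E (a, x)) (cvg_cst _) fx.
  exact.
exact: (@continuous2_cvg _ _ _ _ _ _ (fun t => a *: f t) g (fun x y : E => x + y) (a *: x) y (@add_continuous E (_, _)) af gy).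
Qed.

Lemma lcs_convex_nbhs0 U : nbhs 0 U ->
  exists V, [/\ nbhs 0 V, V `<=` U & convex_set V].
Proof.
have [B Bc [Bo Bb]] := @locally_convex R E.
move=> /Bb [V [BV V0] VU]; exists V; split => //; last by apply: Bc; rewrite inE.
by apply: open_nbhs_nbhs; split => //; exact: Bo.
Qed.

End lcs_theory.
Arguments lcs_cvg_lin {R E T G FG f g} a {x y} _ _.

(* The initial topology for linear maps phi i : T -> {family fam, X -> F} is a
   Hausdorff locally convex vector topology when the maps are bounded on the
   members of fam and separate points. *)
Section initial_lcs.
Context {R : realType} {I : Type} {X : choiceType} {F : lcsType R}
  {T : lmodType R} (fam : set X -> Prop) (phi : I -> T -> X -> F).

Definition init_fam := sup_topology (fun i =>
  Uniform.class (initial_topology (phi i : T -> {family fam, X -> F}))).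

HB.instance Definition _ := Uniform.on init_fam.
HB.instance Definition _ := GRing.Lmodule.copy init_fam T.

Lemma initial_cvgP (S : choiceType) (Y : topologicalType) (f : S -> Y)
  (G : set_system S) (t : S) : Filter G ->
  G --> (t : initial_topology f) <-> f @ G --> f t.
Proof.
move=> FG; split=> [Gt|Gt].
  apply: (@cvg_trans _ (f @ nbhs (t : initial_topology f))).
    by move=> A; exact: Gt.
  exact: (@initial_continuous S Y f).
move=> A; rewrite nbhsE => -[B [[C oC <-] Ct] CA].
by apply: (filterS CA); apply: Gt; apply: open_nbhs_nbhs.
Qed.

Lemma init_fam_cvgP (G : set_system T) (t : T) : Filter G ->
  G --> (t : init_fam) <->
  forall i A U, fam A -> nbhs 0 U ->
    G [set s | forall p, A p -> U (phi i s p - phi i t p)].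
Proof.
move=> FG; split.
- move=> /cvg_sup Gt i A U fA U0.
  have /initial_cvgP/fam_cvgP/(_ A fA) H := Gt i.
  apply: (H [set f | forall p, A p -> U (f p - phi i t p)]); apply/uniform_nbhs.
  exists [set xy : F * F | U (xy.2 - xy.1)]; split => //.
  have : entourage [set xy : F * F | U (xy.1 - xy.2)].
    by rewrite lcs_entourageE; exists U.
  exact: entourage_inv.
- move=> H; apply/cvg_sup => i; apply/initial_cvgP.
  apply/fam_cvgP => A fA B /uniform_nbhs [E [/entourage_inv eE EB]].
  move: eE; rewrite lcs_entourageE => -[U U0 UE].
  apply: (@filterS _ G _ _ _ _ (H i A U fA U0)) => s sA; apply: EB => p Ap.
  exact: (UE (phi i s p, phi i t p) (sA p Ap)).
Qed.

Hypothesis phi_lin : forall i a s t p,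
  phi i (a *: s + t) p = a *: phi i s p + phi i t p.
Hypothesis phi_bnd : forall i A U t, fam A -> nbhs 0 U ->
  \forall a \near (0 : R^o), forall p, A p -> U (a *: phi i t p).

Let phi0 i p : phi i 0 p = 0.
Proof. by have := phi_lin i (-1) 0 0 p; rewrite !scaleN1r !addNr. Qed.

Let phiD i s t p : phi i (s + t) p = phi i s p + phi i t p.
Proof. by rewrite -[s]scale1r phi_lin !scale1r. Qed.

Let phiZ i a s p : phi i (a *: s) p = a *: phi i s p.
Proof. by rewrite -[a *: s]addr0 phi_lin phi0 addr0. Qed.

Let phiB i s t p : phi i (s - t) p = phi i s p - phi i t p.
Proof. by rewrite phiD -scaleN1r phiZ scaleN1r. Qed.

Let fam_nbhs0 i A U (t : init_fam) : fam A -> nbhs 0 U ->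
  nbhs t [set s | forall p, A p -> U (phi i s p - phi i t p)].
Proof. by move=> fA U0; apply: (init_fam_cvgP t _).1. Qed.

Lemma init_fam_add_continuous : continuous (fun x : init_fam * init_fam => x.1 + x.2).
Proof.
move=> [x y]; apply/(@init_fam_cvgP (_ @ _)) => i A U fA /lcs_split [V V0 VU].
exists ([set s | forall p, A p -> V (phi i s p - phi i x p)],
        [set s | forall p, A p -> V (phi i s p - phi i y p)]).
  by split; exact: fam_nbhs0.
move=> [s t] [/= sx ty] p Ap.
rewrite !phiD opprD addrACA; apply: VU; [exact: sx|exact: ty].
Qed.

Lemma init_fam_scale_continuous :
  continuous (fun z : R^o * init_fam => z.1 *: z.2).
Proof.
move=> [a x]; apply/(@init_fam_cvgP (_ @ _)) => i A U fA /lcs_split [V V0 VU].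
have := @scale_continuous R F (a, 0) V; rewrite /= scaler0 => /(_ V0).
case=> -[B W] /= [Ba W0] BW.
have Va : nbhs (a : R^o) [set b | forall p, A p -> V ((b - a) *: phi i x p)].
  have /lcs_nbhs0P : nbhs (0 : R^o) _ := phi_bnd i x fA V0.
  move=> H; apply/(@lcs_nbhs0P R R^o); apply: filterS H => b /=.
  by rewrite addrK addr0.
exists (B `&` [set b | forall p, A p -> V ((b - a) *: phi i x p)],
        [set s | forall p, A p -> W (phi i s p - phi i x p)]).
  by split; [exact: filterI|exact: fam_nbhs0].
move=> [b s] [/= [Bb bV] sx] p Ap; rewrite !phiZ.
have -> : b *: phi i s p - a *: phi i x p =
  b *: (phi i s p - phi i x p) + (b - a) *: phi i x p.
  by rewrite scalerBr scalerBl addrA subrK.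
by apply: VU; [apply: (BW (b, _)); split => //; exact: sx|exact: bV].
Qed.

Let nbhsTT (x : init_fam) (A : set init_fam) : nbhs 0 [set u | A (u + x)] -> nbhs x A.
Proof.
move=> A0.
have := @nbhsT_subproof R init_fam _ init_fam_add_continuous x A0.
by apply: filterS => _ [z Uz <-] /=; rewrite addrC.
Qed.

Let nbhsTT0 (x : init_fam) (A : set init_fam) : nbhs x A -> nbhs 0 [set u | A (u + x)].
Proof.
move=> Ax.
have := @nbhsB_subproof R init_fam _ init_fam_add_continuous x (-x) Ax.
rewrite addNr; apply: filterS => _ [z Uz <-] /=.
by rewrite addrC addrA subrr add0r.
Qed.

Let convex_interior (C : set init_fam) : convex_set C -> convex_set C°.
Proof.
move=> cC x y l; rewrite !inE /interior => /nbhsTT0 Cx /nbhsTT0 Cy.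
apply: nbhsTT; near=> u => /=.
have Cux : C (u + x) by near: u.
have Cuy : C (u + y) by near: u.
have := cC (u + x) (u + y) l; rewrite !inE => /(_ Cux Cuy).
congr (C _); rewrite /conv /=.
by rewrite !scalerDr addrACA -scalerDl unstable.add_onemK scale1r.
Unshelve. all: by end_near. Qed.

Lemma init_fam_locally_convex :
  exists2 B : set_system init_fam, (forall b, b \in B -> convex_set b) & basis B.
Proof.
exists [set C | open C /\ convex_set C]; first by move=> b; rewrite inE => -[].
split; first by move=> b [].
move=> x A Ax.
pose Phi := filter_from [set C : set init_fam | nbhs x C /\ convex_set C] id.
have PhiF : Filter Phi.
  apply: filter_from_filter.
    by exists setT; split; [exact: filterT|move=> ? ? ? _ _; rewrite inE].
  move=> B C [Bx cB] [Cx cC]; exists (B `&` C) => //; split; first exact: filterI.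
  move=> u v l; rewrite !inE => -[Bu Cu] [Bv Cv]; split.
    by have := cB u v l; rewrite !inE; exact.
  by have := cC u v l; rewrite !inE; exact.
have /(_ A Ax) : Phi --> (x : init_fam).
  apply/init_fam_cvgP => i K U fK U0.
  have [V [V0 VU cV]] := lcs_convex_nbhs0 U0.
  exists [set s | forall p, K p -> V (phi i s p - phi i x p)]; last first.
    by move=> s sV p Kp; apply: VU; exact: sV.
  split; first exact: fam_nbhs0.
  move=> u v l; rewrite !inE => uV vV p Kp.
  have := cV (phi i u p - phi i x p) (phi i v p - phi i x p) l.
  rewrite !inE => /(_ (uV p Kp) (vV p Kp)); congr (V _); rewrite /conv /=.
  rewrite phiD !phiZ !scalerBr addrACA -opprD -scalerDl unstable.add_onemK scale1r.
  by [].
case=> C [Cx cC] CA; exists C° => /=.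
  by split; [split; [exact: open_interior|exact: convex_interior]|exact: Cx].
by apply: subset_trans CA; exact: interior_subset.
Qed.

Let sup_entS (S : choiceType) (J : Type) (Tc : J -> Uniform S)
    (Psi : set_system (S * S)) : Filter Psi ->
  (forall j E, @entourage (Uniform.Pack (Tc j)) E -> Psi E) ->
  forall E, @entourage (sup_topology Tc) E -> Psi E.
Proof.
move=> FP H E [B [D _ <-] DE]; apply: (filterS DE).
apply: filter_bigI => -[[j G] /asboolP] /= eG _; exact: (H j).
Qed.

Let sup_ent_base (S : choiceType) (J : Type) (Tc : J -> Uniform S) j E :
  @entourage (Uniform.Pack (Tc j)) E -> @entourage (sup_topology Tc) E.
Proof.
move=> eE; exists E => //=.
have h : `[< @entourage (Uniform.Pack (Tc j)) E >] by exact/asboolP.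
exists [fset exist _ (j : {classic J}, E) h]%fset => //.
  by move=> k _; rewrite inE.
rewrite eqEsubset; split=> z /=.
  by move=> /(_ (exist _ (j : {classic J}, E) h)); apply; rewrite /= inE.
by move=> Ez k /=; rewrite inE => /eqP ->.
Qed.

Lemma init_fam_entourageE : @entourage init_fam =
  filter_from (nbhs (0 : init_fam))
    (fun U => [set xy : init_fam * init_fam | U (xy.1 - xy.2)]).
Proof.
apply/seteqP; split=> E.
  set Psi := filter_from _ _.
  have FPsi : Filter Psi.
    apply: filter_from_filter; first by exists setT; exact: filterT.
    by move=> A B A0 B0; exists (A `&` B) => //; exact: filterI.
  apply: sup_entS => {E} i E [G eG GE]; apply: (filterS GE) => {E GE}.
  have : ((fun xy => (phi i xy.1, phi i xy.2)) @ Psi) G; last by [].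
  move: G eG; apply: sup_entS => -[A fA] G /=.
  rewrite uniform_entourage => -[H + HG].
  rewrite lcs_entourageE => -[U U0 UH].
  exists [set s | forall p, A p -> U (phi i s p - phi i 0 p)].
    exact: fam_nbhs0.
  move=> [x y] /= xyU; apply: HG => p Ap /=; apply: UH => /=.
  by have := xyU p Ap; rewrite phiB phi0 subr0.
case=> U U0 UE; apply: filterS UE _.
pose Th : set_system init_fam :=
  [set U | entourage [set xy : init_fam * init_fam | U (xy.1 - xy.2)]].
have FTh : Filter Th.
  split; first exact: filterT.
    by move=> A B; exact: filterI.
  by move=> A B AB; apply: filterS => xy /AB.
have /(_ U U0) : Th --> (0 : init_fam); last by [].
apply/init_fam_cvgP => i A V fA V0.
apply: (@sup_ent_base _ _ _ i).
exists [set fg : (X -> F) * (X -> F) | forall p, A p -> V (fg.1 p - fg.2 p)].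
  apply: (@sup_ent_base _ _ _ (existT _ A fA)).
  rewrite uniform_entourage; exists [set xy : F * F | V (xy.1 - xy.2)] => //.
  by rewrite lcs_entourageE; exists V.
by move=> [x y] /= xyV p Ap; rewrite phiB phi0 subr0; exact: xyV.
Qed.

Lemma init_fam_hausdorff :
  (forall s t, (forall i A p, fam A -> A p -> phi i s p = phi i t p) -> s = t) ->
  hausdorff_space init_fam.
Proof.
move=> sep x y xy; apply: sep => i A p fA Ap.
apply: (@lcs_hausdorff R F) => U V Ux Vy.
have /lcs_nbhs0P U0 := Ux; have /lcs_nbhs0P V0 := Vy.
have [z [zx zy]] := xy _ _ (@fam_nbhs0 i A _ x fA U0) (@fam_nbhs0 i A _ y fA V0).
exists (phi i z p); split.
  by have := zx p Ap; rewrite /= subrK.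
by have := zy p Ap; rewrite /= subrK.
Qed.

End initial_lcs.

Section partial_derivatives.
Context {R : realType} {d : nat} {F : lcsType R}.
Implicit Types (f g : 'rV[R]_d -> F) (U : set 'rV[R]_d) (x : 'rV[R]_d)
  (s : seq 'I_d).

Definition dquot f (i : 'I_d) x : R -> F :=
  fun h => h^-1 *: (f (h *: delta_mx 0 i + x) - f x).

Definition partially_derivable f i x := exists l : F, dquot f i x @ 0^' --> l.

Definition partial (i : 'I_d) f : 'rV[R]_d -> F :=
  fun x => xget 0 [set l : F | dquot f i x @ 0^' --> l].

Definition ipartial s f := foldr partial f s.

Fixpoint ipartially_derivable U s f : Prop :=
  if s is i :: s' then
    ipartially_derivable U s' f /\
    forall x, U x -> partially_derivable (ipartial s' f) i x
  else True.

(* The multi-index al is turned into the word 0^(al 0) 1^(al 1) ..., so that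
   [ipartial (mword al)] is d_0^(al 0) (d_1^(al 1) (...)). *)
Definition mword (al : 'I_d -> nat) : seq 'I_d :=
  flatten [seq nseq (al i) i | i <- enum 'I_d].

Lemma partialE f i x (l : F) : dquot f i x @ 0^' --> l -> partial i f x = l.
Proof.
move=> fl; rewrite /partial; case: xgetP => [y _ fy|/(_ l)]; last by [].
exact: (@cvg_unique _ (@lcs_hausdorff R F) _ _ _ _ fy fl).
Qed.

Lemma partialP f i x : partially_derivable f i x ->
  dquot f i x @ 0^' --> partial i f x.
Proof. by case=> l fl; rewrite (partialE fl). Qed.

Lemma dquot_near f g i x (l : F) : (\forall y \near x, f y = g y) ->
  dquot f i x @ 0^' --> l -> dquot g i x @ 0^' --> l.
Proof.
move=> fg; apply: cvg_trans; apply: near_eq_cvg.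
have H : (fun h : R => h *: (delta_mx 0 i : 'rV[R]_d) + x) @ (0 : R) --> x.
  have : (fun h : R => h *: (delta_mx 0 i : 'rV[R]_d) + x) @ (0 : R) -->
      (0 : R) *: (delta_mx 0 i : 'rV[R]_d) + x.
    by apply: cvgD; [apply: cvgZr_tmp; exact: cvg_id|exact: cvg_cst].
  by rewrite scale0r add0r.
near=> h; rewrite /dquot (nbhs_singleton fg); congr (_ *: (_ - _)).
near: h; exact: (nbhs_dnbhs (H _ fg)).
Unshelve. all: by end_near. Qed.

Lemma dquot_lin f g (a : R) i x (l m : F) :
  dquot f i x @ 0^' --> l -> dquot g i x @ 0^' --> m ->
  dquot (fun y => a *: f y + g y) i x @ 0^' --> a *: l + m.
Proof.
move=> fl gm; apply: cvg_trans (lcs_cvg_lin a fl gm); apply: near_eq_cvg; near=> h.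
rewrite /dquot scalerA mulrC -scalerA -scalerDr; congr (_ *: _).
by rewrite scalerBr opprD addrACA.
Unshelve. all: by end_near. Qed.

Arguments dquot_lin {f g} a {i x l m} _ _.

Lemma ipartial_lin U (oU : open U) s f g (a : R) :
  ipartially_derivable U s f -> ipartially_derivable U s g ->
  ipartially_derivable U s (fun y => a *: f y + g y) /\
  forall x, U x -> ipartial s (fun y => a *: f y + g y) x =
                   a *: ipartial s f x + ipartial s g x.
Proof.
elim: s => [//|i s IH] /= [/IH {}IH sf] [/IH [dh hE] sg].
have cv x : U x -> dquot (ipartial s (fun y => a *: f y + g y)) i x @ 0^' -->
    a *: partial i (ipartial s f) x + partial i (ipartial s g) x.
  move=> Ux; have := dquot_lin a (partialP (sf x Ux)) (partialP (sg x Ux)).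
  apply: dquot_near; near=> y; rewrite hE//.
  by near: y; exact: open_nbhs_nbhs.
split; last by move=> x Ux; apply: partialE; exact: cv.
by split=> // x Ux; eexists; exact: cv.
Unshelve. all: by end_near. Qed.

Arguments ipartial_lin {U} oU {s f g} a _ _.

Lemma ipartial0 U s : ipartially_derivable U s (fun=> 0 : F) /\
  ipartial s (fun=> 0 : F) = (fun=> 0).
Proof.
elim: s => [//|i s [dh hE]] /=; rewrite hE.
have cv x : dquot (fun=> 0 : F) i x @ 0^' --> (0 : F).
  rewrite (_ : dquot _ _ _ = fun=> 0); first exact: cvg_cst.
  by apply/funext => h; rewrite /dquot subrr scaler0.
split; last by apply/funext => x; exact: partialE.
by split=> // x _; exists 0.
Qed.

End partial_derivatives.
Arguments ipartial_lin {R d F U} oU {s f g} a _ _.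

Section Cl_space.
Variables (R : realType) (d : nat).

(* Subsets of R^d with dense interior. *)
Record domain := Domain {
  dom :> set 'rV[R]_d ;
  dom_dense : dom `<=` closure dom°
}.

(* None stands for ell = oo. *)
Definition below (ell : option nat) (al : 'I_d -> nat) : Prop :=
  if ell is Some l then (\sum_(i < d) al i <= l)%N else True.

Variables (ell : option nat) (D : domain) (F : lcsType R).

(* g : D -> F is a continuous extension of the al-th partial derivative of the
   restriction of gam to the interior of D. Partial derivatives at interior
   points only see gam near the point, so gam is extended by 0 outside D. *)
Definition extends_partial (al : 'I_d -> nat) (gam g : dom D -> F) :=
  continuous g /\ forall x : dom D, D° (val x) ->
    g x = ipartial (mword al) ('valL_(0 : F) gam) (val x).

Definition is_Cl (gam : dom D -> F) : Prop :=
  continuous gam /\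
  forall al, below ell al ->
    [/\ ipartially_derivable D° (mword al) ('valL_(0 : F) gam),
        forall x, D° x ->
          {for x, continuous (ipartial (mword al) ('valL_(0 : F) gam))}
      & exists g, extends_partial al gam g].

Lemma valL_lin a (f g : dom D -> F) :
  'valL_(0 : F) (a *: f + g) = fun x => a *: 'valL_(0 : F) f x + 'valL_(0 : F) g x.
Proof.
by apply/funext => x; rewrite /valL_ /=; case: (_ x) => //=; rewrite scaler0 addr0.
Qed.

Lemma valL_0 : 'valL_(0 : F) (0 : dom D -> F) = fun=> 0.
Proof. by apply/funext => x; rewrite /valL_ /=; case: (_ x). Qed.

Lemma extends_lin al a (f g f' g' : dom D -> F) : 
  ipartially_derivable D° (mword al) ('valL_(0 : F) f) ->
  ipartially_derivable D° (mword al) ('valL_(0 : F) g) ->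
  extends_partial al f f' -> extends_partial al g g' ->
  extends_partial al (a *: f + g) (a *: f' + g').
Proof.
move=> df dg [cf' f'E] [cg' g'E]; split.
  by move=> x; exact: (lcs_cvg_lin a (cf' x) (cg' x)).
move=> x Dx; rewrite valL_lin.
rewrite (ipartial_lin (@open_interior _ D) a df dg).2//.
by rewrite -f'E// -g'E.
Qed.

Definition Cl_pred : pred (dom D -> F) := fun gam => `[< is_Cl gam >].

Let Cl_submod : submod_closed Cl_pred.
Proof.
split.
  apply/asboolP; split; first by move=> x; apply: (@cst_continuous _ _ (0 : F)).
  move=> al _; rewrite valL_0; have [H E] := @ipartial0 R d F D° (mword al).
  split => //; rewrite ?E; first by move=> x _; apply: (@cst_continuous _ _ (0 : F)).
  exists (fun=> 0); split; first by move=> x; apply: (@cst_continuous _ _ (0 : F)).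
  by move=> x _; rewrite valL_0 E.
move=> a f g => /asboolP [cf Hf] /asboolP [cg Hg].
apply/asboolP; split.
  by move=> x; exact: (lcs_cvg_lin a (cf x) (cg x)).
move=> al b; have [df ff [f' ef]] := Hf al b; have [dg fg [g' eg]] := Hg al b.
have [H E] := ipartial_lin (@open_interior _ D) a df dg.
split; [by rewrite valL_lin| |].
- move=> x Dx; rewrite valL_lin.
  have nD : \forall y \near x, D° y.
    by apply: open_nbhs_nbhs; split; [exact: open_interior|].
  rewrite /prop_for /continuous_at [X in _ --> X]E//.
  apply: cvg_trans (lcs_cvg_lin a (ff x Dx) (fg x Dx)).
  apply: (@near_eq_cvg _ _ (nbhs x) (nbhs_filter x)); near=> y.
  have Dy : D° y by near: y.
  by rewrite E.
- by exists (a *: f' + g'); exact: extends_lin.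
Unshelve. all: by end_near. Qed.

HB.instance Definition _ := GRing.isSubmodClosed.Build R (dom D -> F) Cl_pred Cl_submod.

Record Cl := MkCl { Cl_fun :> dom D -> F ; Cl_funP : Cl_fun \in Cl_pred }.

HB.instance Definition _ := [isSub for Cl_fun].
HB.instance Definition _ := [Choice of Cl by <:].
HB.instance Definition _ := [SubChoice_isSubLmodule of Cl by <:].

(* Unique by [extends_unique]. *)
Definition Cl_partial (al : 'I_d -> nat) (gam : Cl) : dom D -> F :=
  xget (fun=> 0) [set g | extends_partial al gam g].

Lemma extends_unique al gam g h :
  extends_partial al gam g -> extends_partial al gam h -> g = h.
Proof.
move=> [cg gE] [ch hE]; apply/funext => x.
apply: (@lcs_hausdorff R F) => A B gA hB.
have [W [oW Wx] WAB] : exists2 W, open_nbhs (val x) W &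
    set_val @^-1` W `<=` (g @^-1` A) `&` (h @^-1` B).
  have : nbhs x ((g @^-1` A) `&` (h @^-1` B)).
    by apply: filterI; [exact: cg|exact: ch].
  rewrite nbhsE => -[_ [[W oW <-] Wx] WAB]; exists W => //; split => //.
have [z [Dz Wz]] := dom_dense (set_valP x) (open_nbhs_nbhs (conj oW Wx)).
pose z' : dom D := exist _ z (mem_set (interior_subset Dz)).
have [/= zA zB] := WAB z' Wz.
by exists (g z'); split => //; rewrite gE// -hE.
Qed.

Lemma Cl_partialP al (gam : Cl) : below ell al ->
  extends_partial al gam (Cl_partial al gam).
Proof.
move=> b; have /asboolP [_ /(_ al b) [_ _ [g eg]]] := Cl_funP gam.
exact: (@xgetPex _ (fun=> 0) [set g | extends_partial al gam g] (ex_intro _ g eg)).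
Qed.

Lemma Cl_partial_lin al a (f g : Cl) : below ell al ->
  Cl_partial al (a *: f + g) = a *: Cl_partial al f + Cl_partial al g.
Proof.
move=> b; apply: extends_unique; first exact: Cl_partialP.
have /asboolP [_ /(_ al b) [df _ _]] := Cl_funP f.
have /asboolP [_ /(_ al b) [dg _ _]] := Cl_funP g.
by apply: extends_lin => //; exact: Cl_partialP.
Qed.

Lemma Cl_partial0 (f : Cl) : Cl_partial (fun=> 0%N) f = f.
Proof.
have b : below ell (fun=> 0%N) by rewrite /below; case: ell => // l; rewrite big1.
apply: extends_unique; first exact: Cl_partialP.
have /asboolP [cf _] := Cl_funP f; split => // x Dx.
have -> : mword (fun=> 0%N : nat) = [::] :> seq 'I_d.
  by rewrite /mword; elim: (enum _).
by rewrite /= -[in LHS](valLK 0 (Cl_fun f)).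
Qed.

Definition multi_index := {al : 'I_d -> nat | below ell al}.

(* On continuous maps the topology of {family compact, _ -> _} is the
   compact-open topology, see [compact_open_fam_compactP]. *)
HB.instance Definition _ := Uniform.copy Cl
  (sup_topology (fun al : multi_index => Uniform.class
    (initial_topology (Cl_partial (sval al) : Cl -> {family compact, dom D -> F})))).

Let phi (al : multi_index) : Cl -> dom D -> F := Cl_partial (sval al).

Let phi_lin (al : multi_index) a (s t : Cl) p :
  phi al (a *: s + t) p = a *: phi al s p + phi al t p.
Proof. by rewrite /phi Cl_partial_lin//; exact: (svalP al). Qed.

Let phi_bnd (al : multi_index) (A : set (dom D)) (U : set F) (t : Cl) :
  compact A -> nbhs 0 U ->
  \forall a \near (0 : R^o), forall p, A p -> U (a *: phi al t p).
Proof.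
move=> /compact_near_coveringP cA U0.
have [ct _] := Cl_partialP t (svalP al).
apply: (@cA R^o (nbhs (0 : R^o)) (fun a p => U (a *: phi al t p)) _) => p Ap.
have := @scale_continuous R F (0, phi al t p) U; rewrite /= scale0r => /(_ U0).
case=> -[B W] /= [B0 Wp] BW; exists (phi al t @^-1` W, B); first by split => //; exact: ct.
by move=> [q a] [/= Wq Ba]; exact: (BW (a, _)).
Qed.

Let phi_sep (s t : Cl) : (forall (al : multi_index) (A : set (dom D)) p,
  compact A -> A p -> phi al s p = phi al t p) -> s = t.
Proof.
have b : below ell (fun=> 0%N) by rewrite /below; case: ell => // l; rewrite big1.
move=> H; apply/val_inj/funext => p.
have := H (exist _ _ b) [set p] p (@compact_set1 _ p) erefl.
by rewrite /phi !Cl_partial0.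
Qed.

HB.instance Definition _ := PreTopologicalNmodule_isTopologicalNmodule.Build Cl
  (@init_fam_add_continuous R multi_index (dom D) F Cl compact phi phi_lin).
HB.instance Definition _ := TopologicalNmodule_isTopologicalLmodule.Build R Cl
  (@init_fam_scale_continuous R multi_index (dom D) F Cl compact phi phi_lin phi_bnd).
HB.instance Definition _ := Uniform_isTvs.Build R Cl
  (@init_fam_locally_convex R multi_index (dom D) F Cl compact phi phi_lin).
HB.instance Definition _ := Tvs_isLcs.Build R Cl
  (@init_fam_hausdorff R multi_index (dom D) F Cl compact phi phi_sep) (@init_fam_entourageE R multi_index (dom D) F Cl compact phi phi_lin).
End Cl_space.

Section dual_space.
Context {R : realType} (E : lcsType R).

Definition dual_pred : pred (E -> R^o) :=
  fun lam => `[< linear lam /\ continuous lam >].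

Let dual_submod : submod_closed dual_pred.
Proof.
split.
  apply/asboolP; split; first by move=> a x y /=; rewrite scaler0 addr0.
  by move=> x; apply: (@cst_continuous _ _ (0 : R^o)).
move=> a f g /asboolP [lf cf] /asboolP [lg cg]; apply/asboolP; split.
  move=> b x y; change (a *: f (b *: x + y) + g (b *: x + y) =
    b *: (a *: f x + g x) + (a *: f y + g y)).
  rewrite lf lg !scalerDr !scalerA (mulrC a b) -!addrA; congr (_ + _).
  by rewrite addrCA.
by move=> x; exact: (lcs_cvg_lin a (cf x) (cg x)).
Qed.

HB.instance Definition _ :=
  GRing.isSubmodClosed.Build R (E -> R^o) dual_pred dual_submod.

Record dual := MkDual { dual_fun :> E -> R^o ; dual_funP : dual_fun \in dual_pred }.

HB.instance Definition _ := [isSub for dual_fun].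
HB.instance Definition _ := [Choice of dual by <:].
HB.instance Definition _ := [SubChoice_isSubLmodule of dual by <:].

Lemma dual_linear (lam : dual) : linear lam.
Proof. by have /asboolP [] := dual_funP lam. Qed.

(* E with the weak topology sigma(E, E'). *)
Definition weak_space :=
  initial_topology (fun (x : E) => (fun lam : dual => lam x) : {ptws dual -> R^o}).
HB.instance Definition _ := Uniform.on weak_space.

Definition absolutely_convex (A : set E) := forall (a b : R) x y,
  `|a| + `|b| <= 1 -> A x -> A y -> A (a *: x + b *: y).

Definition mackey_family (A : set E) :=
  absolutely_convex A /\ compact (A : set weak_space).

(* E' with the Mackey topology tau(E', E): uniform convergence on the absolutely
   convex weakly compact subsets of E. *)
Definition mackey_dual :=
  initial_topology (fun lam : dual => dual_fun lam : {family mackey_family, E -> R^o}).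
HB.instance Definition _ := Uniform.on mackey_dual.

Definition equicontinuous_set (H : set dual) := equicontinuous H dual_fun.

End dual_space.

Section tensor_product.
Context {R : realType} (E1 E2 : lmodType R).

(* The algebraic tensor product: formal sums of pairs modulo the congruence
   generated by bilinearity. Since (-1) *: x is available, the quotient of the
   free commutative monoid on E1 * E2 is already a group. *)
Inductive teq : seq (E1 * E2) -> seq (E1 * E2) -> Prop :=
| teq_refl s : teq s s
| teq_sym s t : teq s t -> teq t s
| teq_trans s t u : teq s t -> teq t u -> teq s u
| teq_cat s s' t t' : teq s s' -> teq t t' -> teq (s ++ t) (s' ++ t')
| teq_catC s t : teq (s ++ t) (t ++ s)
| teq_0 y : teq [:: (0, y)] [::]
| teq_Dl x x' y : teq [:: (x + x', y)] [:: (x, y); (x', y)]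
| teq_Dr x y y' : teq [:: (x, y + y')] [:: (x, y); (x, y')]
| teq_Z a x y : teq [:: (a *: x, y)] [:: (x, a *: y)].

Definition teqb : rel (seq (E1 * E2)) := fun s t => `[< teq s t >].

Let teqb_equiv : equiv_class_of teqb.
Proof.
split=> [s|s t|s t u].
- by apply/asboolP; exact: teq_refl.
- by apply/asboolP/asboolP => H; exact: teq_sym.
- by move=> /asboolP H /asboolP K; apply/asboolP; exact: teq_trans H K.
Qed.

Canonical teqb_equivRel := EquivRelPack teqb_equiv.

Definition tensor := {eq_quot teqb_equivRel}.

HB.instance Definition _ := Choice.on tensor.
HB.instance Definition _ := EqQuotient.on tensor.

Definition tclass (s : seq (E1 * E2)) : tensor := \pi_tensor s.

Lemma tclassP s t : tclass s = tclass t <-> teq s t.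
Proof.
split=> [/eqP|H]; first by rewrite eqmodE => /asboolP.
by apply/eqP; rewrite eqmodE; exact/asboolP.
Qed.

Lemma tclassK (t : tensor) : tclass (repr t) = t.
Proof. exact: reprK. Qed.

Definition tscale_seq (a : R) (s : seq (E1 * E2)) := [seq (a *: p.1, p.2) | p <- s].

Definition tzero : tensor := tclass [::].
Definition tadd (t u : tensor) : tensor := tclass (repr t ++ repr u).
Definition tscale (a : R) (t : tensor) : tensor := tclass (tscale_seq a (repr t)).
Definition topp (t : tensor) : tensor := tscale (-1) t.

Let repr_teq s : teq (repr (tclass s)) s.
Proof. by apply/tclassP; rewrite tclassK. Qed.

Let taddE s t : tadd (tclass s) (tclass t) = tclass (s ++ t).
Proof. by apply/tclassP; exact: teq_cat. Qed.

Let tscale_seq_teq a s t : teq s t -> teq (tscale_seq a s) (tscale_seq a t).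
Proof.
elim=> {s t} [s|s t _|s t u _ IH1 _ IH2|s s' t t' _ IH1 _ IH2|s t|y|x x' y|x y y'|b x y] /=.
- exact: teq_refl.
- exact: teq_sym.
- exact: teq_trans IH1 IH2.
- by rewrite /tscale_seq !map_cat; exact: teq_cat.
- by rewrite /tscale_seq !map_cat; exact: teq_catC.
- by rewrite scaler0; exact: teq_0.
- by rewrite scalerDr; exact: teq_Dl.
- exact: teq_Dr.
- by rewrite scalerA mulrC -scalerA; exact: teq_Z.
Qed.

Let tscaleE a s : tscale a (tclass s) = tclass (tscale_seq a s).
Proof. by apply/tclassP; exact: tscale_seq_teq. Qed.

Let taddA : associative tadd.
Proof.
move=> t u v; rewrite -(tclassK t) -(tclassK u) -(tclassK v).
by rewrite !taddE catA.
Qed.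

Let taddC : commutative tadd.
Proof.
move=> t u; rewrite -(tclassK t) -(tclassK u) !taddE.
by apply/tclassP; exact: teq_catC.
Qed.

Let tadd0 : left_id tzero tadd.
Proof. by move=> t; rewrite -(tclassK t) taddE. Qed.

Let tscale_seqD a b s : teq (tscale_seq (a + b) s) (tscale_seq a s ++ tscale_seq b s).
Proof.
elim: s => [|[x y] s IH] /=; first exact: teq_refl.
rewrite -cat1s -[_ :: (_ ++ _)]cat1s -[_ :: tscale_seq b s]cat1s.
have H : teq ([:: (a *: x, y)] ++ (tscale_seq a s ++ ([:: (b *: x, y)] ++ tscale_seq b s)))
   ([:: (a *: x, y); (b *: x, y)] ++ (tscale_seq a s ++ tscale_seq b s)).
  rewrite -[[:: _; _]]cat1s -catA; apply: teq_cat; first exact: teq_refl.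
  by rewrite !catA; apply: teq_cat; [exact: teq_catC|exact: teq_refl].
apply: teq_trans (teq_sym H); apply: teq_cat => //.
by rewrite scalerDl; exact: teq_Dl.
Qed.

Let tscale_seq0 s : teq (tscale_seq 0 s) [::].
Proof.
elim: s => [|[x y] s IH] /=; first exact: teq_refl.
by rewrite scale0r -cat1s -[[::]]cats0; apply: teq_cat => //; exact: teq_0.
Qed.

Let tscale1 : left_id 1 tscale.
Proof.
move=> t; rewrite -(tclassK t) tscaleE; congr tclass.
by rewrite /tscale_seq -[RHS]map_id; apply: eq_map => -[x y] /=; rewrite scale1r.
Qed.

Let tscaleDl t : {morph tscale^~ t : a b / a + b >-> tadd a b}.
Proof.
move=> a b; rewrite -(tclassK t) !tscaleE taddE.
by apply/tclassP; exact: tscale_seqD.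
Qed.

Let tscaleDr : right_distributive tscale tadd.
Proof.
move=> a t u; rewrite -(tclassK t) -(tclassK u).
move: (repr t) (repr u) => s v; rewrite [tadd (tclass s) _]taddE tscaleE.
rewrite [tscale a (tclass s)]tscaleE [tscale a (tclass v)]tscaleE taddE.
by rewrite /tscale_seq map_cat.
Qed.

Let tscaleA a b t : tscale a (tscale b t) = tscale (a * b) t.
Proof.
rewrite -(tclassK t) !tscaleE; congr tclass; rewrite /tscale_seq -map_comp.
by apply: eq_map => -[x y] /=; rewrite scalerA.
Qed.

Let taddN : left_inverse tzero topp tadd.
Proof.
move=> t; rewrite /topp -[X in tadd _ X]tscale1 -tscaleDl addNr.
by rewrite -(tclassK t) tscaleE; apply/tclassP; exact: tscale_seq0.
Qed.

HB.instance Definition _ := GRing.isZmodule.Build tensor taddA taddC tadd0 taddN.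
HB.instance Definition _ := GRing.Zmodule_isLmodule.Build R tensor
  tscaleA tscale1 tscaleDr tscaleDl.

Definition pure_tensor (x : E1) (y : E2) : tensor := tclass [:: (x, y)].

Lemma tclassE s : tclass s = \sum_(p <- s) pure_tensor p.1 p.2.
Proof.
elim: s => [|[x y] s IH]; first by rewrite big_nil.
by rewrite big_cons /= -IH; symmetry; exact: (taddE [:: (x, y)] s).
Qed.

End tensor_product.

Section injective_tensor_product.
Context {R : realType} (E1 E2 : lcsType R).

Definition eps_op (s : seq (E1 * E2)) : dual E1 -> E2 :=
  fun lam => \sum_(p <- s) lam p.1 *: p.2.

Lemma eps_op_teq s t : teq s t -> eps_op s = eps_op t.
Proof.
move=> st; apply/funext => lam; rewrite /eps_op.
have lin := dual_linear lam.
have l0 : lam 0 = 0.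
  by have := lin (-1) 0 0; rewrite !scaleN1r !addNr.
elim: st => {s t} [s|s t _ //|s t u _ -> _ -> //|s s' t t' _ IH1 _ IH2|s t|y|x x' y|x y y'|a x y].
- by [].
- by rewrite !big_cat /= IH1 IH2.
- by rewrite !big_cat /= addrC.
- by rewrite big_seq1 big_nil /= l0 scale0r.
- rewrite !big_cons !big_nil !addr0 /= -scalerDl; congr (_ *: _).
  by rewrite -[x in LHS]scale1r lin scale1r.
- by rewrite !big_cons !big_nil !addr0 /= scalerDr.
- rewrite !big_seq1 /= -[a *: x]addr0 lin l0 addr0 scalerA.
  by rewrite mulrC.
Qed.

(* L((E1)'_tau, E2) with uniform convergence on equicontinuous subsets of E1'. *)
Definition eps_space := set_type
  [set u : {family (@equicontinuous_set R E1), dual E1 -> E2} |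
    linear (u : dual E1 -> E2) /\ continuous (u : mackey_dual E1 -> E2)].

Let mackey_singleton (x : E1) :
  mackey_family [set y | exists2 a : R, `|a| <= 1 & y = a *: x].
Proof.
split.
  move=> a b _ _ ab [r r1 ->] [s s1 ->]; exists (a * r + b * s).
    apply: le_trans (ler_normD _ _) _; rewrite !normrM; apply: le_trans ab.
    by apply: lerD; rewrite ler_piMr.
  by rewrite scalerDl !scalerA.
have -> : [set y | exists2 a : R, `|a| <= 1 & y = a *: x] =
    (fun a : R => a *: x) @` `[-1, 1]%classic.
  apply/seteqP; split=> y.
    by case=> a a1 ->; exists a => //=; rewrite in_itv /= -ler_norml.
  by case=> a /=; rewrite in_itv /= -ler_norml => a1 <-; exists a.
apply: continuous_compact; last exact: segment_compact.
apply: continuous_subspaceT => a.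
apply/initial_cvgP; apply/cvg_sup => lam; apply/initial_cvgP.
suff : (fun b : R => lam (b *: x) : R^o) @ a --> (lam (a *: x) : R^o) by [].
have lamZ b : lam (b *: x) = b * lam x.
  have lin := dual_linear lam.
  have l0 : lam 0 = 0 by have := lin (-1) 0 0; rewrite !scaleN1r !addNr.
  by rewrite -[b *: x]addr0 lin l0 addr0.
under eq_fun do rewrite lamZ.
rewrite lamZ; apply: cvgMr_tmp; exact: cvg_id.
Qed.

Lemma eps_op_linear s : linear (eps_op s).
Proof.
move=> a l m; rewrite /eps_op scaler_sumr -big_split; apply: eq_bigr => p _ /=.
by rewrite scalerDl scalerA.
Qed.

Lemma eps_op_continuous s : continuous (eps_op s : mackey_dual E1 -> E2).
Proof.
elim: s => [|[x y] s IH].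
  rewrite (_ : eps_op [::] = fun=> 0).
    by move=> l; apply: (@cst_continuous _ _ (0 : E2)).
  by apply/funext => l; rewrite /eps_op big_nil.
rewrite (_ : eps_op _ = fun l : dual E1 => 1 *: (l x *: y) + eps_op s l); last first.
  by apply/funext => l; rewrite /eps_op big_cons /= scale1r.
move=> l; apply: (@lcs_cvg_lin R E2 (mackey_dual E1) (nbhs (l : mackey_dual E1)) _
  (fun m : mackey_dual E1 => m x *: y) (eps_op s) 1 (l x *: y)); last exact: IH.
have lx : (fun l : mackey_dual E1 => l x : R^o) @ l --> (l x : R^o).
  have Hl : nbhs l --> (l : mackey_dual E1) by [].
  have /initial_cvgP/fam_cvgP/(_ _ (mackey_singleton x)) H := Hl.
  move=> A; rewrite -nbhs_entourageE => -[V eV VA].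
  apply: (H [set f | A (f x)]); apply/uniform_nbhs; exists V; split => //.
  move=> h /(_ x) hx; apply: VA; apply/xsectionP; apply: hx.
  by exists 1; rewrite ?normr1 ?scale1r.
exact: (@continuous2_cvg _ R^o E2 E2 _ _ (fun m : mackey_dual E1 => m x) (fun=> y)
  (fun (a : R^o) (z : E2) => a *: z) (l x) y
  (@scale_continuous R E2 (l x, y)) lx (cvg_cst _)).
Qed.

Definition eps_embed (t : tensor E1 E2) : eps_space :=
  exist _ (eps_op (repr t)) (mem_set (conj (eps_op_linear (repr t))
    (@eps_op_continuous (repr t)))).

Lemma eps_embedE s : val (eps_embed (tclass s)) = eps_op s.
Proof. by apply: eps_op_teq; apply/tclassP; rewrite tclassK. Qed.

Lemma eps_embed_pure x y : val (eps_embed (pure_tensor x y)) = fun lam => lam x *: y.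
Proof. by rewrite eps_embedE; apply/funext => lam; rewrite /eps_op big_seq1. Qed.

(* E1 (x) E2 with the epsilon-topology. *)
Definition inj_tensor := initial_topology eps_embed.
HB.instance Definition _ := Uniform.on inj_tensor.
HB.instance Definition _ := GRing.Lmodule.copy inj_tensor (tensor E1 E2).

End injective_tensor_product.

Definition lcs_complete (R : realType) (E : lcsType R) : Prop :=
  forall G : set_system E, ProperFilter G -> cauchy G -> exists x : E, G --> x.

(* (G, iota) is a completion of E: G is complete Hausdorff and iota is a linear
   topological embedding with dense image. This determines (G, iota) up to a
   unique isomorphism. *)
Definition is_completion (R : realType) (E : PreUniformLmodule.type R)
    (G : lcsType R) (iota : {linear E -> G}) :=
  [/\ lcs_complete G, injective iota,
      forall A : set E, open A <-> exists2 B : set G, open B & iota @^-1` B = A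
    & closure (range iota) = setT].

Definition lcs_iso (R : realType) (E G : lcsType R) :=
  exists (f : {linear E -> G}) (g : {linear G -> E}),
    [/\ cancel f g, cancel g f, continuous f & continuous g].

(* Main.v *)
(* Both sides are completions of F (x) C^l(D, R). The map j sending a sum of
   x (x) g to the sum of g(.) x induces the epsilon-topology, because an
   equicontinuous set of functionals l satisfies l(d^al (j t)(p)) =
   d^al (u_t l)(p), where u_t is the operator l |-> sum of l(x) g, and polars of
   equicontinuous sets form a basis of 0-neighbourhoods of F (Hahn-Banach).
   C^l(D, F) is complete: a Cauchy filter converges with all derivatives
   uniformly on compact sets, D is metrizable, and the mean value theorem
   identifies the limits of the derivatives.
   The image of j is dense: for x0 interior and s < 1 close to 1,
   x |-> s x + (1 - s) x0 maps a compact subset K of D onto a compact subset A of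
   the interior. Cut gam off by 0 away from A (discontinuously) and take its
   Bernstein polynomials P_n on a cube containing A. The derivatives of P_n are
   Bernstein means of difference quotients of gam, which the mean value theorem
   compares with the derivatives of gam near A, while the far nodes carry
   exponentially small weight, beating the factor n^|al| of the difference
   quotients across the cut. Hence P_n(s x + (1 - s) x0), which lies in the image
   of j, approximates gam in C^l on K. *)

Require Import Defs.
From HB Require Import structures.
From mathcomp Require Import all_boot all_order all_algebra.
From mathcomp Require Import ring lra.
From mathcomp Require Import all_classical all_reals all_analysis.
Set Implicit Arguments.
Unset Strict Implicit.
Unset Printing Implicit Defensive.
Import Order.TTheory GRing.Theory Num.Theory.
Import numFieldNormedType.Exports.
Local Open Scope classical_set_scope.
Local Open Scope ring_scope.

(** * The Hahn-Banach theorem *)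

(** Every estimate in [F] is tested against the functionals [l] of an equicontinuous set, with
    constants independent of [l]: the mean value theorem and Chernoff's bound concern real
    functions, and a polar turns [|l y| <= 1] for all these [l] back into membership in a
    neighbourhood of 0. Errors are therefore budgeted to add up to 1. Bernstein means suit the
    tensor product because such a mean is by construction a finite sum of values of the function
    weighted by scalar polynomials, and because its derivatives are again Bernstein means, of lower
    degree, so that positivity is available at every order. They are encoded as iterated convex
    combinations along a word in the coordinates; a derivative deletes one letter. The order of
    choices matters: the contraction factor [s] depends only on the map, [K] and the derivatives
    tested; then come a radius, bounds and a cube for the contracted compact set; the degree [n]
    comes last. *)

Lemma convex_setP (R : realType) (E : lmodType R) (A : set E) :
  convex_set A -> forall (a b : R) x y, A x -> A y ->
  0 <= a -> 0 <= b -> a + b = 1 -> A (a *: x + b *: y).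
Proof.
move=> cA a b x y Ax Ay a0 b0 ab.
have a1 : a <= 1 by rewrite -ab lerDl.
have i01 : Itv.spec (Itv.num_sem (R:=R)) (Itv.Real `[0%Z, 1%Z]) a.
  by rewrite /= /Itv.num_sem /= num_real in_itv /= a0 a1.
have := cA x y (Itv.mk i01); rewrite !inE => /(_ Ax Ay).
by congr (A _); rewrite /conv /= /unstable.onem -[in LHS]ab [a + b]addrC addrK.
Qed.

(** Splits an error [e] between two infima weighted by [a] and [b]: each is approached up to
    [e / (a + b + 1)]. The [+ 1] keeps the denominator positive when both weights vanish. *)
Lemma weight_le (R : realType) (a b e : R) : 0 <= a -> 0 <= b -> 0 < e ->
  (a + b) * (e / (a + b + 1)) <= e.
Proof.
move=> a0 b0 e0; have c0 : 0 < a + b + 1 by lra.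
by rewrite mulrCA ler_piMr ?(ltW e0)// ler_pdivrMr// mul1r lerDl.
Qed.

Section sublinear.
Context {R : realType} {E : lmodType R}.
Implicit Types (x y z : E).

Definition sublinear (q : E -> R) := forall (a b : R) x y, 0 <= a -> 0 <= b ->
  q (a *: x + b *: y) <= a * q x + b * q y.

Lemma sublinear0 (q : E -> R) : sublinear q -> q 0 = 0.
Proof.
move=> sq; apply/eqP; rewrite eq_le; apply/andP; split.
  by have := sq 0 0 0 0 (lexx _) (lexx _); rewrite !scale0r !mul0r !addr0.
have := sq 1 1 0 0 ler01 ler01; rewrite !scaler0 addr0 !mul1r.
by lra.
Qed.

Lemma sublinearD (q : E -> R) x y : sublinear q -> q (x + y) <= q x + q y.
Proof. by move=> /(_ 1 1 x y ler01 ler01); rewrite !scale1r !mul1r. Qed.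

Lemma sublinear_geN (q : E -> R) x : sublinear q -> - q (- x) <= q x.
Proof.
move=> sq; have := sublinearD x (- x) sq; rewrite subrr sublinear0//.
by lra.
Qed.

Lemma sublinearZ (q : E -> R) (a : R) x : sublinear q -> 0 <= a -> q (a *: x) = a * q x.
Proof.
move=> sq a0; have le b y : 0 <= b -> q (b *: y) <= b * q y.
  move=> b0; have := sq b 0 y 0 b0 (lexx _).
  by rewrite scaler0 addr0 mul0r addr0.
apply/eqP; rewrite eq_le le//=; case: (ltrgtP 0 a) a0 => // [a0 _|<- _].
  have ai : 0 <= a^-1 by rewrite invr_ge0 ltW.
  have := le a^-1 (a *: x) ai; rewrite scalerA mulVf ?gt_eqF// scale1r.
  by rewrite ler_pdivlMl.
by rewrite scale0r mul0r sublinear0.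
Qed.

(* The infimum over [t >= 0] of [q (x + t *: z) - t * q z] is the smallest
   sublinear functional below [q] obtained by pushing [q (- z)] down to [- q z];
   a minimal [q] must therefore already satisfy [q (- z) = - q z]. *)
Definition odd_at (q : E -> R) z x : R :=
  inf [set r | exists2 t : R, 0 <= t & r = q (x + t *: z) - t * q z].

Let odd_at_lb (q : E -> R) z x : sublinear q ->
  lbound [set r | exists2 t : R, 0 <= t & r = q (x + t *: z) - t * q z] (- q (- x)).
Proof.
move=> sq _ [t t0 ->]; rewrite -sublinearZ//.
have := sublinearD (x + t *: z) (- x) sq; rewrite addrAC subrr add0r.
by lra.
Qed.

Lemma odd_at_le (q : E -> R) z x (t : R) : sublinear q -> 0 <= t ->
  odd_at q z x <= q (x + t *: z) - t * q z.
Proof.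
by move=> sq t0; apply: ge_inf; [exists (- q (- x)); exact: odd_at_lb|exists t].
Qed.

Lemma odd_at_sublinear (q : E -> R) z : sublinear q -> sublinear (odd_at q z).
Proof.
move=> sq a b x y a0 b0; apply/ler_addgt0Pr => e e0.
pose c := (a + b + 1).
have c0 : 0 < c by rewrite /c; lra.
have adh w : exists2 t : R, 0 <= t & q (w + t *: z) - t * q z < odd_at q z w + e / c.
  have [||_ [t t0 ->]] := @inf_adherent R
    [set r | exists2 t : R, 0 <= t & r = q (w + t *: z) - t * q z] (e / c).
  - by rewrite divr_gt0.
  - split; last by exists (- q (- w)); exact: odd_at_lb.
    by eexists; exists 0.
  - by exists t.
have [t t0 ht] := adh x; have [s s0 hs] := adh y.
(* Near-optimal parameters [t] for [x] and [s] for [y] combine to an admissible parameter for the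
   combination of [x] and [y]. *)
apply: (le_trans (@odd_at_le q z _ (a * t + b * s) sq _)).
  by rewrite addr_ge0// mulr_ge0.
have -> : a *: x + b *: y + (a * t + b * s) *: z =
    a *: (x + t *: z) + b *: (y + s *: z).
  by rewrite !scalerDr !scalerA scalerDl addrACA.
have := sq a b (x + t *: z) (y + s *: z) a0 b0.
have ha := ler_wpM2l a0 (ltW ht); have hb := ler_wpM2l b0 (ltW hs).
have ec := weight_le a0 b0 e0; rewrite -/c in ec.
by move: ha hb ec; lra.
Qed.

Lemma sublinear_linear (q : E -> R) : sublinear q -> (forall z, q (- z) = - q z) ->
  linear (q : E -> R^o).
Proof.
move=> sq qN a x y.
have qD u v : q (u + v) = q u + q v.
  apply/eqP; rewrite eq_le sublinearD//=.
  by have := sublinear_geN (u + v) sq; have := sublinearD (- u) (- v) sq;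
    rewrite opprD !qN; lra.
rewrite qD; congr (_ + _); case: (lerP 0 a) => [a0|/ltW a0]; first exact: sublinearZ.
by rewrite -[a]opprK scaleNr qN sublinearZ ?oppr_ge0// scaleNr.
Qed.

Let chain_lb (p : E -> R) (Q : set {q | sublinear q /\ forall x, q x <= p x}) x : sublinear p ->
  lbound [set r | exists2 q, Q q & r = sval q x] (- p (- x)).
Proof.
move=> sp _ [[q [sq qp]] _ ->] /=.
by apply: le_trans (sublinear_geN x sq); rewrite lerN2.
Qed.

(** Zorn's lemma for the reversed pointwise order: a maximal element for [rel] is a minimal
    sublinear functional below [p]. The bound of a nonempty chain is its pointwise infimum. *)
Lemma minimal_sublinear (p : E -> R) : sublinear p ->
  exists q, [/\ linear (q : E -> R^o) & forall x, q x <= p x].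
Proof.
move=> sp; pose T := {q | sublinear q /\ forall x, q x <= p x}.
pose rel : T -> T -> bool := fun (q r : T) => `[< forall x, sval r x <= sval q x >].
have [||||[q [sq qp]] qmin] := @Zorn T rel.
- by move=> q; apply/asboolP.
- move=> q r s /asboolP qr /asboolP rs; apply/asboolP => x.
  exact: le_trans (rs x) (qr x).
- move=> [q hq] [r hr] /asboolP /= qr /asboolP /= rq; have e : q = r.
    by apply/funext => x; apply/eqP; rewrite eq_le qr rq.
  by subst r; congr exist; exact: Prop_irrelevance.
- move=> Q Qtot; have [[q0 Qq0]|Q0] := pselect (exists q0, Q q0); last first.
    exists (exist _ p (conj sp (fun x => lexx _))) => s Qs.
    by exfalso; apply: Q0; exists s.
  pose m x := inf [set r | exists2 q, Q q & r = sval q x].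
  have m_le q x : Q q -> m x <= sval q x.
    move=> Qq; apply: ge_inf; last by exists q.
    by exists (- p (- x)); exact: chain_lb sp.
  have adh x e : 0 < e -> exists2 q, Q q & sval q x < m x + e.
    move=> e0; have [||_ [q Qq ->]] :=
      @inf_adherent R [set r | exists2 q, Q q & r = sval q x] e; [by []| |by exists q].
    split; last by exists (- p (- x)); exact: chain_lb sp.
    by exists (sval q0 x); exists q0.
  have sm : sublinear m.
    move=> a b x y a0 b0; apply/ler_addgt0Pr => e e0.
    pose c := (a + b + 1).
    have c0 : 0 < c by rewrite /c; lra.
    have [q Qq qx] := adh x (e / c) (divr_gt0 e0 c0).
    have [r Qr ry] := adh y (e / c) (divr_gt0 e0 c0).
    (* Sublinearity of the infimum needs a single member of the chain that is nearly minimal at [x]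
       and at [y]; totality provides it. *)
    have [k [Qk kx ky]] : exists k, [/\ Q k, sval k x <= sval q x & sval k y <= sval r y].
      by have [/asboolP qr|/asboolP rq] := Qtot q r Qq Qr; [exists r|exists q].
    apply: (le_trans (m_le k _ Qk)).
    apply: (le_trans ((svalP k).1 a b x y a0 b0)).
    have ha := ler_wpM2l a0 (ltW (le_lt_trans kx qx)).
    have hb := ler_wpM2l b0 (ltW (le_lt_trans ky ry)).
    have ec := weight_le a0 b0 e0; rewrite -/c in ec.
    by move: ha hb ec; lra.
  have mp x : m x <= p x by apply: le_trans ((svalP q0).2 x); exact: m_le.
  by exists (exist _ m (conj sm mp)) => s Qs; apply/asboolP => x; exact: m_le.
exists q; split => //; apply: sublinear_linear => // z.
have oz x : odd_at q z x <= q x.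
  have := odd_at_le z x sq (lexx 0); rewrite scale0r addr0 mul0r.
  by lra.
pose o : T := exist _ (odd_at q z)
  (conj (odd_at_sublinear z sq) (fun x => le_trans (oz x) (qp x))).
have qo : exist _ q (conj sq qp) = o by apply/esym/qmin/asboolP.
have := odd_at_le z (- z) sq ler01.
have -> : odd_at q z = q by have /(congr1 sval) := qo.
rewrite scale1r addNr sublinear0// mul1r.
by have := sublinear_geN z sq; lra.
Qed.

(** Minimising below [odd_at p y] instead of [p] builds the prescribed value in: [odd_at p y] is at
    most [- p y] at [- y], so a linear functional below it is at least [p y] at [y]. *)
Lemma Hahn_Banach (p : E -> R) y : sublinear p ->
  exists q, [/\ linear (q : E -> R^o), forall x, q x <= p x & p y <= q y].
Proof.
move=> sp; have [q [lq qp]] := minimal_sublinear (odd_at_sublinear y sp).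
exists q; split => // [x|].
  apply: (le_trans (qp x)).
  by have := odd_at_le y x sp (lexx 0); rewrite scale0r addr0 mul0r; lra.
have := le_trans (qp (- y)) (odd_at_le y (- y) sp ler01).
rewrite scale1r addNr sublinear0// mul1r.
have -> : q (- y) = - q y.
  have l0 : q 0 = 0 by have := lq (-1) 0 0; rewrite !scaleN1r !addNr.
  by have := lq (-1) y 0; rewrite !scaleN1r !addr0 l0 addr0.
by lra.
Qed.

End sublinear.

(** * Gauges, equicontinuous sets and polars *)

Section polar.
Context {R : realType} {E : lcsType R}.

Lemma dualD (l : dual E) x y : l (x + y) = l x + l y.
Proof. by have := dual_linear l 1 x y; rewrite !scale1r. Qed.

Lemma dual0 (l : dual E) : l 0 = 0.
Proof. by have := dual_linear l (-1) 0 0; rewrite !scaleN1r !addNr. Qed.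

Lemma dualZ (l : dual E) (a : R) x : l (a *: x) = a * l x.
Proof. by have := dual_linear l a x 0; rewrite !addr0 dual0 addr0. Qed.

Lemma dualN (l : dual E) x : l (- x) = - l x.
Proof. by rewrite -scaleN1r dualZ mulN1r. Qed.

Lemma dualB (l : dual E) x y : l (x - y) = l x - l y.
Proof. by rewrite dualD dualN. Qed.

Lemma dual_continuous (l : dual E) : continuous l.
Proof. by have /asboolP [] := dual_funP l. Qed.

Lemma lcs_scale_cvg0 (x : E) (U : set E) : nbhs 0 U ->
  \forall a \near (0 : R), U (a *: x).
Proof.
move=> U0; have := @scale_continuous R E (0, x) U; rewrite /= scale0r => /(_ U0).
case=> -[B W] /= [B0 Wx] BW; apply: filterS B0 => a Ba.
by apply: (BW (a, x)); split => //; exact: nbhs_singleton.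
Qed.

Lemma lcs_nbhs0Z (a : R) (U : set E) : nbhs 0 U -> nbhs 0 [set x | U (a *: x)].
Proof.
move=> U0; have := @scale_continuous R E (a, 0) U; rewrite /= scaler0 => /(_ U0).
case=> -[B W] /= [Ba W0] BW; apply: filterS W0 => x Wx.
by apply: (BW (a, x)); split => //; exact: nbhs_singleton.
Qed.

Lemma lcs_nbhs0N (U : set E) : nbhs 0 U -> nbhs 0 [set x | U (- x)].
Proof. by move=> /(lcs_nbhs0Z (-1)); apply: filterS => x /=; rewrite scaleN1r. Qed.

Section gauge.
Variables (V : set E) (V0 : nbhs 0 V) (cV : convex_set V).

(** The Minkowski functional. [V] is convex but perhaps not balanced, so it is sublinear rather than
    a seminorm; [lcs_polar] restores symmetry with [V] and its reflection. *)
Definition gauge (x : E) : R :=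
  inf [set t | 0 < t /\ exists2 w, V w & x = t *: w].

Let gauge_lb x : lbound [set t | 0 < t /\ exists2 w, V w & x = t *: w] 0.
Proof. by move=> t [/ltW]. Qed.

Lemma gauge_le x (t : R) w : 0 < t -> V w -> x = t *: w -> gauge x <= t.
Proof.
move=> t0 Vw xw; apply: ge_inf; first by exists 0; exact: gauge_lb.
by split => //; exists w.
Qed.

Lemma gauge_adh x (e : R) : 0 < e ->
  exists t, [/\ 0 < t, t < gauge x + e & exists2 w, V w & x = t *: w].
Proof.
move=> e0; have [|t [t0 xw]] := @inf_adherent R
    [set t | 0 < t /\ exists2 w, V w & x = t *: w] e e0; last by exists t.
split; last by exists 0; exact: gauge_lb.
have [r /= r0 rU] := lcs_scale_cvg0 x V0.
have r2 : 0 < r / 2 by rewrite divr_gt0.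
exists (r / 2)^-1; split; first by rewrite invr_gt0.
exists ((r / 2) *: x); last by rewrite scalerA mulVf ?gt_eqF// scale1r.
apply: rU => /=; rewrite sub0r normrN gtr0_norm//.
by rewrite ltr_pdivrMr// ltr_pMr// ltr1n.
Qed.

Lemma gauge_sublinear : sublinear gauge.
Proof.
move=> a b x y a0 b0; apply/ler_addgt0Pr => e e0.
pose c := (a + b + 1).
have c0 : 0 < c by rewrite /c; lra.
have [t [t0 ht [v Vv xv]]] := gauge_adh x (divr_gt0 e0 c0).
have [s [s0 hs [w Vw yw]]] := gauge_adh y (divr_gt0 e0 c0).
have ha := ler_wpM2l a0 (ltW ht); have hb := ler_wpM2l b0 (ltW hs).
have ec := weight_le a0 b0 e0; rewrite -/c in ec.
have V00 : V 0 by exact: nbhs_singleton.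
have at0 : 0 <= a * t by rewrite mulr_ge0// ltW.
have bs0 : 0 <= b * s by rewrite mulr_ge0// ltW.
apply: (@le_trans _ _ (a * t + b * s)); last by move: ha hb ec; lra.
rewrite xv yw !scalerA; have [k0|k0] := ltrP 0 (a * t + b * s).
  apply: (gauge_le k0 (convex_setP cV Vv Vw (divr_ge0 at0 (ltW k0))
    (divr_ge0 bs0 (ltW k0)) _)).
    by rewrite -mulrDl divff ?gt_eqF.
  by rewrite scalerDr !scalerA ![(a * t + b * s) * _]mulrC !divfK ?gt_eqF.
(* Degenerate case: the combination is the vector 0, for which every positive [f] is admissible
   because [V] contains 0. *)
have [-> ->] : a * t = 0 /\ b * s = 0 by split; lra.
rewrite !scale0r !addr0; apply/ler_addgt0Pr => f f0; rewrite add0r.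
by apply: (gauge_le f0 V00); rewrite scaler0.
Qed.

End gauge.

Lemma equicontinuous_setP (H : set (dual E)) :
  equicontinuous_set H <->
  forall e : R, 0 < e -> \forall x \near (0 : E), forall l, H l -> `|l x| <= e.
Proof.
split=> [eH e e0|eH x A].
  have eb : entourage [set xy : R^o * R^o | ball xy.1 e xy.2].
    by rewrite -entourage_ballE; exists e.
  have := eH 0 _ eb; apply: filterS => x /= xH l Hl.
  by have := xH l Hl; rewrite -ball_normE /ball_ /= dual0 sub0r normrN => /ltW.
rewrite -entourage_ballE => -[e /= e0 eA]; apply/lcs_nbhs0P.
have e2 : 0 < e / 2 by rewrite divr_gt0.
have := eH _ e2; apply: filterS => y /= yH l Hl.
apply: eA => /=; rewrite -ball_normE /ball_ /= dualD opprD addrCA subrr addr0 normrN.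
by apply: (le_lt_trans (yH l Hl)); lra.
Qed.

(** If [y] lies outside the convex set [V], its gauge is at least 1, and a linear functional below
    the gauge that attains it at [y] separates [y] from [V]. *)
Lemma lcs_polar (U : set E) : nbhs 0 U ->
  exists2 H : set (dual E), equicontinuous_set H &
    forall y, (forall l, H l -> `|l y| <= 1) -> U y.
Proof.
move=> U0; have [V [V0 VU cV]] := lcs_convex_nbhs0 U0.
have Wn : nbhs 0 (V `&` [set x | V (- x)]) by apply: filterI => //; exact: lcs_nbhs0N.
(* The bound 2 creates the gap that separation lacks, since [V] need not be closed: the separating
   [q] satisfies only [q y >= 1], while [2 * q] belongs to this set and exceeds 1 at [y]. *)
exists [set l | forall x, V x -> V (- x) -> `|l x| <= 2].
  apply/equicontinuous_setP => e e0.
  have := lcs_nbhs0Z (2 / e) Wn.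
  apply: filterS => x [Vx VNx] l Hl; have := Hl _ Vx VNx.
  rewrite dualZ normrM gtr0_norm ?divr_gt0// mulrAC ler_pdivrMr//.
  by rewrite ler_pM2l.
move=> y yH; apply: VU; apply: contrapT => nVy.
have sg := gauge_sublinear V0 cV.
have [q [lq qg gq]] := Hahn_Banach y sg.
have gV x : V x -> gauge V x <= 1.
  by move=> Vx; apply: (gauge_le ltr01 Vx); rewrite scale1r.
have gy : 1 <= gauge V y.
  rewrite leNgt; apply/negP => gy1; apply: nVy.
  have g0 : 0 < 1 - gauge V y by rewrite subr_gt0.
  have [t [t0 + [w Vw ->]]] := gauge_adh V0 y g0; rewrite addrC subrK => t1.
  have := convex_setP cV Vw (nbhs_singleton V0) (ltW t0) _ (subrKC t 1).
  by rewrite scaler0 addr0 subr_ge0; apply; exact: ltW.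
have q0 : q 0 = 0 by have := lq (-1) 0 0; rewrite !scaleN1r !addNr.
have qZ a x : q (a *: x) = a * q x by have := lq a x 0; rewrite !addr0 q0 addr0.
have qN x : q (- x) = - q x by rewrite -scaleN1r qZ mulN1r.
have qV x : V x -> V (- x) -> `|2 * q x| <= 2.
  move=> Vx VNx; rewrite normrM gtr0_norm// -[leRHS]mulr1 ler_pM2l// ler_norml.
  have := le_trans (qg _) (gV _ Vx); have := le_trans (qg _) (gV _ VNx).
  by rewrite qN; lra.
have qP : (fun x => 2 * q x : R^o) \in @dual_pred R E.
  have lin : linear (fun x => 2 * q x : R^o).
    by move=> a u v; rewrite lq mulrDr scalerAr.
  apply/asboolP; split => // x.
  apply/cvgrPdist_le => e e0; apply/lcs_nbhs0P.
  have := lcs_nbhs0Z (2 / e) Wn.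
  apply: filterS => u /= [Vu VNu].
  have -> : 2 * q x - 2 * q (u + x) = - (2 * q u).
    by have := lq 1 u x; rewrite !scale1r => ->; rewrite mulrDr opprD addrCA subrr addr0.
  rewrite normrN; have := qV _ Vu VNu.
  by rewrite qZ mulrCA normrM gtr0_norm ?divr_gt0// mulrAC ler_pdivrMr// ler_pM2l.
have := yH (MkDual qP); rewrite /= => /(_ qV).
have := le_trans gy gq; rewrite ler_norml; lra.
Qed.

End polar.

(** * Partial derivatives and the C^l-topology *)

Section mean_value.
Context {R : realType} {d : nat}.
Implicit Types (q x : 'rV[R]_d) (i : 'I_d).
Local Notation unitv i := (delta_mx 0 i : 'rV[R]_d).

(** Measuring the deviation from a fixed slope [c] allows an increment to be compared directly with
    a target derivative. *)
Lemma dquot_mvt (g : 'rV[R]_d -> R^o) i q (a b c e : R) : a <= b ->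
  (forall t, a <= t <= b -> exists2 l : R^o,
    dquot g i (t *: unitv i + q) @ 0^' --> l & `|l - c| <= e) ->
  `|g (b *: unitv i + q) - g (a *: unitv i + q) - (b - a) * c| <= e * (b - a).
Proof.
move=> ab H; pose G (t : R) : R := g (t *: unitv i + q).
have dG t : a <= t <= b -> is_derive t 1 G (partial i g (t *: unitv i + q)).
  move=> /H [l gl _]; rewrite (partialE gl).
  have Gl : (fun h : R => h^-1 *: ((G \o shift t) (h *: 1) - G t)) @ 0^' --> l.
    apply: cvg_trans gl; apply: near_eq_cvg; near=> h.
    by rewrite /dquot /G /= [h *: 1]mulr1 scalerDl addrA.
  by split; [apply/cvg_ex; exists l|exact: cvg_lim Gl].
have [||s sab ->] := @MVT_segment R G (fun t => partial i g (t *: unitv i + q)) a b ab.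
- by move=> t; rewrite in_itv /= => /andP[at_ tb]; apply: dG; rewrite !ltW.
- apply: derivable_within_continuous => t; rewrite in_itv /= => tab.
  exact: (@ex_derive _ _ _ _ _ _ _ (dG t tab)).
move: sab; rewrite in_itv /= => /H [l gl lc]; rewrite (partialE gl).
rewrite [(b - a) * c]mulrC -mulrBl normrM [`|b - a|]ger0_norm ?subr_ge0//.
by rewrite ler_wpM2r// subr_ge0.
Unshelve. all: by end_near. Qed.

Lemma dquot_mvt0 (g : 'rV[R]_d -> R^o) i (q : 'rV[R]_d) (h c e : R) :
  (forall t, `|t| <= `|h| -> exists2 l : R^o,
    dquot g i (t *: unitv i + q) @ 0^' --> l & `|l - c| <= e) ->
  `|g (h *: unitv i + q) - g q - h * c| <= e * `|h|.
Proof.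
move=> H; case: (lerP 0 h) => [h0|/ltW h0].
  have := @dquot_mvt g i q 0 h c e h0; rewrite scale0r add0r subr0 (ger0_norm h0); apply.
  by move=> t /andP[t0 th]; apply: H; rewrite (ger0_norm h0) ger0_norm.
have := @dquot_mvt g i q h 0 c e h0; rewrite scale0r add0r sub0r => P.
rewrite -normrN (ler0_norm h0).
have -> : - (g (h *: unitv i + q) - g q - h * c) =
    g q - g (h *: unitv i + q) - - h * c.
  by rewrite !opprB mulNr opprK addrC.
apply: P => t /andP[ht t0].
by apply: H; rewrite (ler0_norm h0) ler0_norm// lerN2.
Qed.

End mean_value.

(** * Composition with continuous linear maps *)

Section linear_composition.
Context {R : realType} {d : nat} {E F : lcsType R}.
Variables (T : E -> F) (linT : linear T) (cT : continuous T).
Implicit Types (f : 'rV[R]_d -> E).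

Let T0 : T 0 = 0.
Proof. by have := linT (-1) 0 0; rewrite !scaleN1r !addNr. Qed.

Let TZ a x : T (a *: x) = a *: T x.
Proof. by have := linT a x 0; rewrite !addr0 T0 addr0. Qed.

Let TB x y : T (x - y) = T x - T y.
Proof. by rewrite addrC -scaleN1r linT scaleN1r addrC. Qed.

Lemma dquot_comp f i x (l : E) : dquot f i x @ 0^' --> l ->
  dquot (T \o f) i x @ 0^' --> T l.
Proof.
move=> fl; rewrite (_ : dquot (T \o f) i x = T \o dquot f i x).
  exact: (cvg_comp _ _ fl (@cT l)).
by apply/funext => h; rewrite /dquot /= TZ TB.
Qed.

(** Derivatives are limits of linear combinations of values. Openness of [U] lets the identity for
    the lower derivative be inserted into nearby difference quotients. *)
Lemma ipartial_comp (U : set 'rV[R]_d) s f : open U ->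
  ipartially_derivable U s f ->
  ipartially_derivable U s (T \o f) /\
  forall x, U x -> ipartial s (T \o f) x = T (ipartial s f x).
Proof.
move=> oU; elim: s => [//|i s IH] /= [/IH [dh hE] sf].
have cv x : U x -> dquot (ipartial s (T \o f)) i x @ 0^' -->
    T (partial i (ipartial s f) x).
  move=> Ux; have := dquot_comp (partialP (sf x Ux)).
  apply: dquot_near; near=> y; rewrite hE//.
  by near: y; exact: open_nbhs_nbhs.
split; last by move=> x Ux; apply: partialE; exact: cv.
by split=> // x Ux; eexists; exact: cv.
Unshelve. all: by end_near. Qed.

Variables (ell : option nat) (D : domain R d).

Let valL_comp (gam : dom D -> E) : 'valL_(0 : F) (T \o gam) = T \o 'valL_(0 : E) gam.
Proof.
by apply/funext => x; rewrite /valL_ /=; case: (_ x) => //=; rewrite T0.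
Qed.

Lemma extends_partial_comp al (gam g : dom D -> E) :
  ipartially_derivable D° (mword al) ('valL_(0 : E) gam) ->
  extends_partial al gam g -> extends_partial al (T \o gam) (T \o g).
Proof.
move=> dg [cg gE]; split; first by move=> x; apply: continuous_comp (@cT _); exact: cg.
move=> x Dx; rewrite valL_comp (ipartial_comp (@open_interior _ D) dg).2//.
by rewrite /= gE.
Qed.

Lemma is_Cl_comp (gam : dom D -> E) : is_Cl ell gam -> is_Cl ell (T \o gam).
Proof.
move=> [cg Hg]; split; first by move=> x; apply: continuous_comp (@cT _); exact: cg.
move=> al b; have [dg ctg [g eg]] := Hg al b.
have [dT TE] := ipartial_comp (@open_interior _ D) dg.
split; [by rewrite valL_comp| |by exists (T \o g); exact: extends_partial_comp].
move=> x Dx; rewrite valL_comp /prop_for /continuous_at TE//.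
have nD : \forall y \near x, D° y.
  by apply: open_nbhs_nbhs; split; [exact: open_interior|].
apply: cvg_trans (cvg_comp _ _ (ctg x Dx) (@cT _)).
apply: (@near_eq_cvg _ _ (nbhs x) (nbhs_filter x)); near=> y.
by rewrite TE//; near: y.
Unshelve. all: by end_near. Qed.

Definition Cl_comp (gam : Cl ell D E) : Cl ell D F :=
  MkCl (introT (asboolP _) (is_Cl_comp (elimT (asboolP _) (Cl_funP gam)))).

Lemma Cl_partial_comp al (gam : Cl ell D E) : below ell al ->
  Cl_partial al (Cl_comp gam) = T \o Cl_partial al gam.
Proof.
move=> b; apply: extends_unique; first exact: Cl_partialP.
have /asboolP [_ /(_ al b) [dg _ _]] := Cl_funP gam.
exact: (extends_partial_comp dg (Cl_partialP gam b)).
Qed.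

End linear_composition.

Arguments Cl_comp {R d E F T} linT cT {ell D} gam.

Section Cl_topology.
Context {R : realType} {d : nat} {ell : option nat} {D : domain R d} {F : lcsType R}.
Implicit Types (c : Cl ell D F) (L : seq (multi_index d ell)) (K : set (dom D)).

Lemma Cl_cvgP (G : set_system (Cl ell D F)) c : Filter G ->
  G --> c <-> forall (al : multi_index d ell) K (U : set F), compact K -> nbhs 0 U ->
    G [set s : Cl ell D F |
      forall p, K p -> U (Cl_partial (sval al) s p - Cl_partial (sval al) c p)].
Proof. by move=> FG; exact: (@init_fam_cvgP R (multi_index d ell) (dom D) F (Cl ell D F) compact). Qed.

Definition Cl_ball L K (U : set F) c : set (Cl ell D F) :=
  [set s | forall al p, List.In al L -> K p ->
     U (Cl_partial (sval al) s p - Cl_partial (sval al) c p)].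

Lemma Cl_ball_nbhs L K U c : compact K -> nbhs 0 U -> nbhs c (Cl_ball L K U c).
Proof.
move=> cK U0; elim: L => [|al L IH]; first by apply: filterE => s ? ?.
have : nbhs c [set s : Cl ell D F |
    forall p, K p -> U (Cl_partial (sval al) s p - Cl_partial (sval al) c p)].
  by apply: (Cl_cvgP c _).1.
move=> H; apply: filterS (filterI IH H) => s [sL sal] be p /= [<-|]; first exact: sal.
exact: sL.
Qed.

(** The sets containing such a ball form a filter, and [Cl_cvgP] shows that this filter converges to
    [c]; the supremum topology never has to be unfolded. *)
Lemma Cl_ballP c (A : set (Cl ell D F)) : nbhs c A ->
  exists L K U, [/\ compact K, nbhs 0 U & Cl_ball L K U c `<=` A].
Proof.
pose G : set_system (Cl ell D F) := [set A |
  exists L K U, [/\ compact K, nbhs 0 U & Cl_ball L K U c `<=` A]].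
have FG : Filter G.
  split.
  - exists [::], set0, setT; split => //; [exact: compact0|exact: filterT].
  - move=> B C [L [K [U [cK U0 sB]]]] [M [K' [V [cK' V0 sC]]]].
    exists (L ++ M), (K `|` K'), (U `&` V); split.
    + exact: compactU.
    + exact: filterI.
    + move=> s H; split.
        by apply: sB => al p aL Kp; apply: (H _ _ _ _).1; [apply/List.in_app_iff; left|left].
      by apply: sC => al p aL Kp; apply: (H _ _ _ _).2; [apply/List.in_app_iff; right|right].
  - move=> B C BC [L [K [U [cK U0 sB]]]]; exists L, K, U; split => //.
    exact: subset_trans BC.
suff : G --> c by move=> /(_ A) /[apply].
apply/Cl_cvgP => al K U cK U0; exists [:: al], K, U; split => // s H p Kp.
by apply: H => //; left.
Qed.

End Cl_topology.

(** Canonical words are closed under removing the first letter, and the order does not increase.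
    Induction on words thus only meets derivatives that are controlled by the topology. *)
Lemma mword_tail d (al : 'I_d -> nat) i s : mword al = i :: s ->
  exists be : 'I_d -> nat, s = mword be /\ forall j, (be j <= al j)%N.
Proof.
rewrite /mword; have := enum_uniq 'I_d.
elim: (enum _) => [//|j l IH] /= /andP[jl ul].
have [aj|] := posnP (al j).
  rewrite aj /= => /(IH ul) [be [-> le]].
  by exists be; have := le j; rewrite aj leqn0 => /eqP ->.
case aj : (al j) => [//|n] _ [_ <-].
exists (fun k => if k == j then n else al k); split.
  rewrite eqxx; congr (_ ++ flatten _); apply/eq_in_map => k kl.
  by case: eqP => // kj; move: jl; rewrite -kj kl.
by move=> k; case: eqP => // ->; rewrite aj.
Qed.

Lemma below_le d (ell : option nat) (al be : 'I_d -> nat) :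
  (forall j, (be j <= al j)%N) -> below ell al -> below ell be.
Proof. by case: ell => //= l le; apply: leq_trans; exact: leq_sum. Qed.

(** * Completeness of C^l(D, F) *)

Section domain_topology.
Context {R : realType} {d : nat} {D : domain R d}.

Lemma dom_nbhsP (x : dom D) (A : set (dom D)) :
  nbhs x A <-> exists2 W, nbhs (val x) W & set_val @^-1` W `<=` A.
Proof.
split.
  rewrite nbhsE => -[_ [[W oW <-] Wx] WA]; exists W => //.
  exact: open_nbhs_nbhs.
case=> W Wx WA; apply: filterS WA _.
exact: (@initial_continuous (dom D) _ set_val x W Wx).
Qed.

Lemma dom_compact (A : set 'rV[R]_d) : A `<=` D -> compact A ->
  compact (set_val @^-1` A : set (dom D)).
Proof.
move=> AD /compact_near_coveringP cA; apply/compact_near_coveringP => I G P FG H.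
have : \near G, A `<=` (fun y => forall p : dom D, val p = y -> P G p).
  apply: cA => y Ay; pose p : dom D := exist _ y (mem_set (AD y Ay)).
  have [[/= B C] [/dom_nbhsP [W Wp WB] GC] BC] := H p Ay.
  exists (W, C) => // -[z i] [/= Wz Ci] q qz.
  by apply: (BC (q, i)); split => //=; apply: WB; move: Wz; rewrite -qz.
by apply: filterS => i H' p Ap; exact: (H' (val p)).
Qed.

Lemma valL_val (F : lmodType R) (g : dom D -> F) (p : dom D) :
  'valL_(0 : F) g (val p) = g p.
Proof. by rewrite -[in RHS](valLK 0 g). Qed.

Lemma compact_range_cvg (x : dom D) (y : nat -> dom D) : y @ \oo --> x ->
  compact (x |` range y).
Proof.
move=> yx; apply/compact_near_coveringP => J G P FG H.
have [[/= B C] [Bx GC] BC] := H x (or_introl erefl).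
have [N _ yB] := yx B Bx.
have Gn n : (\forall i \near G, forall k, (k < n)%N -> P i (y k)).
  elim: n => [|n IH]; first by near=> i.
  have [[/= B' C'] [B'x GC'] BC'] := H (y n) (or_intror (ex_intro2 _ _ n I erefl)).
  apply: filterS (filterI IH GC') => i [Pi C'i] k; rewrite ltnS leq_eqVlt => /orP[/eqP ->|].
    by apply: (BC' (y n, i)); split => //=; exact: nbhs_singleton.
  exact: Pi.
apply: filterS (filterI GC (Gn N)) => i [Ci Pi] p [->|[k _ <-]].
  by apply: (BC (x, i)); split => //=; exact: nbhs_singleton.
have [kN|Nk] := ltnP k N; first exact: Pi.
by apply: (BC (y k, i)); split => //=; exact: yB.
Unshelve. all: by end_near. Qed.

(* [dom D] is metrizable, hence continuity is tested on convergent sequences,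
   whose ranges together with their limits are compact. *)
Lemma continuous_compact_approx (F : lcsType R) (g : dom D -> F) :
  (forall K U, compact K -> nbhs 0 U -> exists2 f : dom D -> F, continuous f &
    forall p, K p -> U (f p - g p)) -> continuous g.
Proof.
move=> H x A Ax; apply: contrapT => nA.
have far n : exists y : dom D, ball (val x) n.+1%:R^-1 (val y) /\ ~ A (g y).
  apply: contrapT => ny; apply: nA; apply/dom_nbhsP.
  exists (ball (val x) n.+1%:R^-1); first exact: nbhsx_ballx.
  by move=> y xy; apply: contrapT => nAy; apply: ny; exists y.
pose y n := projT1 (cid (far n)).
have yx : y @ \oo --> x.
  move=> B /dom_nbhsP [W /nbhs_ballP [e /= e0 eW] WB].
  suff : \forall n \near \oo, B (y n) by [].
  near=> n; apply: WB; apply: eW.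
  suff ne : n.+1%:R^-1 <= e by apply: (le_ball ne); exact: (projT2 (cid (far n))).1.
  by apply: ltW; near: n; exact: (near_infty_natSinv_lt (PosNum e0)).
have /lcs_nbhs0P/lcs_split [V V0 VA] := Ax.
have [W W0 WV] := lcs_split V0.
have Wn : nbhs 0 (W `&` [set u | W (- u)]) by apply: filterI => //; exact: lcs_nbhs0N.
have [f cf fg] := H _ _ (compact_range_cvg yx) Wn.
have : \forall n \near \oo, W (f (y n) - f x).
  have fx : nbhs (f x) [set u | W (u - f x)].
    by apply/lcs_nbhs0P; apply: filterS W0 => u /=; rewrite addrK.
  exact: (yx _ (cf x _ fx)).
case=> N _ /(_ N (leqnn _)) /= fN.
apply: (projT2 (cid (far N))).2.
have [_ WyN] := fg (y N) (or_intror (ex_intro2 _ _ N I erefl)).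
have [Wx _] := fg x (or_introl erefl).
(* Three small differences are added by two binary splittings; the term [+ 0] pads the sum to
   four. *)
have -> : g (projT1 (cid (far N))) =
    (- (f (y N) - g (y N)) + (f (y N) - f x)) + (f x - g x + 0) + g x.
  by rewrite opprB addr0 !addrA !subrK.
apply: VA; last by apply: WV => //; exact: nbhs_singleton.
by apply: WV.
Unshelve. all: by end_near. Qed.

End domain_topology.

Section interior_points.
Context {R : realType} {d : nat} {ell : option nat} {D : domain R d} {F : lcsType R}.
Implicit Types (x : 'rV[R]_d).

Definition inD x (Dx : D° x) : dom D := exist _ x (mem_set (interior_subset Dx)).

Lemma nbhsD x : D° x -> \forall y \near x, D° y.
Proof. by move=> Dx; apply: open_nbhs_nbhs; split => //; exact: open_interior. Qed.

Lemma valL_in (g : dom D -> F) x (Dx : D° x) : 'valL_(0 : F) g x = g (inD Dx).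
Proof. by rewrite -[x in LHS]/(val (inD Dx)) valL_val. Qed.

Lemma valL_partial (al : multi_index d ell) (s : Cl ell D F) x : D° x ->
  'valL_(0 : F) (Cl_partial (sval al) s) x = ipartial (mword (sval al)) ('valL_(0 : F) s) x.
Proof.
move=> Dx; have [_ /(_ (inD Dx) Dx) <-] := Cl_partialP s (svalP al).
exact: valL_in.
Qed.

Lemma valL_continuous (g : dom D -> F) x : continuous g -> D° x ->
  {for x, continuous ('valL_(0 : F) g)}.
Proof.
move=> cg Dx A; rewrite (valL_in _ Dx) => /cg /dom_nbhsP [W Wx WA].
have Dn := nbhsD Dx.
suff : \forall y \near x, A ('valL_(0 : F) g y) by [].
near=> y; have Wy : W y by near: y.
have Dy : D° y by near: y.
by rewrite (valL_in _ Dy); exact: (WA (inD Dy)).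
Unshelve. all: by end_near. Qed.

End interior_points.

Lemma below0 d (ell : option nat) : below ell (fun _ : 'I_d => 0%N).
Proof. by case: ell => //= l; rewrite big1. Qed.

Section completeness.
Context {R : realType} {d : nat} {ell : option nat} {D : domain R d} {F : lcsType R}.
Hypothesis F_complete : lcs_complete F.
Implicit Types (al : multi_index d ell) (K : set (dom D)) (U : set F).

Lemma Cl_partialB al (s t : Cl ell D F) p :
  Cl_partial (sval al) (s - t) p = Cl_partial (sval al) s p - Cl_partial (sval al) t p.
Proof.
rewrite -[s - t]addrC -scaleN1r Cl_partial_lin; last exact: svalP.
by rewrite [LHS]/= scaleN1r addrC.
Qed.

Variables (G : set_system (Cl ell D F)) (PG : ProperFilter G) (cG : cauchy G).

Let cauchyU al K U : compact K -> nbhs 0 U -> exists2 S, G S &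
  forall s t p, S s -> S t -> K p -> U (Cl_partial (sval al) s p - Cl_partial (sval al) t p).
Proof.
move=> cK U0.
have := Cl_ball_nbhs [:: al] 0 cK U0; set B := Cl_ball _ _ _ _ => B0.
have : entourage [set xy : Cl ell D F * Cl ell D F | B (xy.1 - xy.2)].
  by rewrite lcs_entourageE; exists B.
move=> /cG [[S T] /= [GS GT] ST]; exists (S `&` T); first exact: filterI.
move=> s t p [Ss _] [_ Tt] Kp.
have := ST (s, t) (conj Ss Tt) al p (or_introl erefl) Kp.
by rewrite Cl_partialB -[0](subrr 0) Cl_partialB subrr subr0.
Qed.

Let lim al (p : dom D) : F :=
  xget 0 [set y | (fun s => Cl_partial (sval al) s p) @ G --> y].

Let limP al p : (fun s => Cl_partial (sval al) s p) @ G --> lim al p.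
Proof.
apply: (@xgetPex _ 0 [set y | (fun s => Cl_partial (sval al) s p) @ G --> y]).
apply: F_complete => A; rewrite lcs_entourageE => -[U U0 UA].
have [S GS SU] := cauchyU al (@compact_set1 _ p) U0.
exists ((fun s => Cl_partial (sval al) s p) @` S, (fun s => Cl_partial (sval al) s p) @` S).
  by split; apply: (@filterS _ G _ S) => // s Ss; exists s.
by move=> [_ _] [/= [s Ss <-] [t St <-]]; apply: UA; exact: SU.
Qed.

(** The Cauchy estimate is uniform on [K]; at each point it is passed to the limit through some [t]
    chosen for that point. *)
Let lim_unif al K U : compact K -> nbhs 0 U ->
  G [set s | forall p, K p -> U (Cl_partial (sval al) s p - lim al p)].
Proof.
move=> cK /lcs_split [V V0 VU].
have [S GS SV] := cauchyU al cK V0.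
apply: (@filterS _ G _ S) => // s Ss p Kp.
have : nbhs (lim al p) [set y | V (y - lim al p)].
  by apply/lcs_nbhs0P; apply: filterS V0 => u /=; rewrite addrK.
move=> /limP GV; have [t [St Vt]] := filter_ex (@filterI _ G _ _ _ GS GV).
by rewrite -(subrK (Cl_partial (sval al) t p) (Cl_partial _ s p)) -addrA; apply: VU => //; exact: SV.
Qed.

Let lim_continuous al : continuous (lim al).
Proof.
apply: continuous_compact_approx => K U cK U0.
have [s sU] := filter_ex (lim_unif al cK U0).
by exists (Cl_partial (sval al) s) => //; have [] := Cl_partialP s (svalP al).
Qed.

Local Notation unitv i := (delta_mx 0 i : 'rV[R]_d).

Let dquot_partial al (be : multi_index d ell) i (s : Cl ell D F) y :
  D° y -> mword (sval al) = i :: mword (sval be) ->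
  dquot ('valL_(0 : F) (Cl_partial (sval be) s)) i y @ 0^' -->
    'valL_(0 : F) (Cl_partial (sval al) s) y.
Proof.
move=> Dy ab; have /asboolP [_ /(_ _ (svalP al)) [+ _ _]] := Cl_funP s.
rewrite valL_partial// ab => -[_ /(_ y Dy)] /partialP; apply: dquot_near.
by apply: filterS (nbhsD Dy) => z Dz; rewrite valL_partial.
Qed.

(* The mean value theorem for [l \o partial], [l] in an equicontinuous set,
   turns uniform convergence of the derivatives into convergence of the
   difference quotients. *)
Let dquot_lim al (be : multi_index d ell) i x : D° x -> mword (sval al) = i :: mword (sval be) ->
  dquot ('valL_(0 : F) (lim be)) i x @ 0^' --> 'valL_(0 : F) (lim al) x.
Proof.
move=> Dx ab A Ax; have /lcs_nbhs0P/lcs_polar [H eH HA] := Ax.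
have e4 : 0 < 4^-1 :> R by [].
have H4 := (equicontinuous_setP H).1 eH _ e4.
have cx : \forall y \near x, D° y /\ forall l, H l ->
    `|l ('valL_(0 : F) (lim al) y - 'valL_(0 : F) (lim al) x)| <= 4^-1.
  have : nbhs (lim al (inD Dx)) [set y | forall l, H l -> `|l (y - lim al (inD Dx))| <= 4^-1].
    by apply/lcs_nbhs0P; apply: filterS H4 => u /=; rewrite addrK.
  move=> /lim_continuous /dom_nbhsP [W Wx WH].
  near=> y.
  have Wy : W y by near: y.
  have Dy : D° y by near: y; exact: nbhsD.
  split => // l Hl; rewrite (valL_in _ Dy) (valL_in _ Dx).
  exact: (WH (inD Dy)).
have tx : (fun t : R => t *: unitv i + x) @ (0 : R) --> x.
  have : (fun t : R => t *: unitv i + x) @ (0 : R) --> (0 : R) *: unitv i + x.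
    by apply: cvgD; [apply: cvgZr_tmp; exact: cvg_id|exact: cvg_cst].
  by rewrite scale0r add0r.
have [r /= r0 rD] := tx _ cx.
suff : \forall h \near (0 : R)^', A (dquot ('valL_(0 : F) (lim be)) i x h) by [].
near=> h.
have h0 : h != 0 by near: h; exact: nbhs_dnbhs_neq.
have hr : `|h| < r.
  near: h; apply: nbhs_dnbhs; exists r => //= t /=.
  by rewrite sub0r normrN.
have seg t : `|t| <= `|h| -> D° (t *: unitv i + x) /\ forall l, H l ->
    `|l ('valL_(0 : F) (lim al) (t *: unitv i + x) - 'valL_(0 : F) (lim al) x)| <= 4^-1.
  by move=> th; apply: rD => /=; rewrite sub0r normrN (le_lt_trans th).
rewrite -(subrK ('valL_(0 : F) (lim al) x) (dquot _ _ _ _)); apply: HA => l Hl.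
set a := 'valL_(0 : F) (lim be) (h *: unitv i + x).
set b := 'valL_(0 : F) (lim be) x; set c := 'valL_(0 : F) (lim al) x.
suff hh : `|l a - l b - h * l c| <= `|h|.
  have -> : l (dquot ('valL_(0 : F) (lim be)) i x h - c) = h^-1 * (l a - l b - h * l c).
    by rewrite dualB dualZ dualB [RHS]mulrBr mulKf.
  by rewrite normrM normfV ler_pdivrMl ?normr_gt0// mulr1.
pose A1 := (fun t : R => t *: unitv i + x) @` `[- `|h|, `|h|]%classic.
have A1D : A1 `<=` D.
  move=> y [t /=]; rewrite in_itv /= -ler_norml => /seg [Dt _] <-.
  exact: interior_subset Dt.
have cA1 : compact A1.
  apply: continuous_compact; last exact: segment_compact.
  apply: continuous_subspaceT => z.
  by apply: cvgD; [apply: cvgZr_tmp; exact: cvg_id|exact: cvg_cst].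
have A1t t : `|t| <= `|h| -> A1 (t *: unitv i + x).
  by move=> th; exists t => //=; rewrite in_itv /= -ler_norml.
have cK := dom_compact A1D cA1.
(* The approximant [s] is chosen after [h], since its values at both ends of the increment must be
   accurate to a quarter of [|h|]. Its derivative is within [4^-1 + 4^-1] of [l c] on the segment,
   so the mean value theorem costs another half, and the total is [|h|]. *)
have hh0 : 0 < `|h| / 4 by rewrite divr_gt0 ?normr_gt0.
have [s [s1 s2]] := filter_ex (filterI (lim_unif al cK H4)
  (lim_unif be cK ((equicontinuous_setP H).1 eH _ hh0))).
have est2 t : `|t| <= `|h| -> `|l ('valL_(0 : F) (Cl_partial (sval be) s) (t *: unitv i + x)) -
    l ('valL_(0 : F) (lim be) (t *: unitv i + x))| <= `|h| / 4.
  move=> th; have [Dt _] := seg t th.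
  rewrite !(valL_in _ Dt) -dualB.
  by apply: s2 => //; exact: A1t.
have est1 t : `|t| <= `|h| -> `|l ('valL_(0 : F) (Cl_partial (sval al) s) (t *: unitv i + x)) -
    l c| <= 2^-1.
  move=> th; have [Dt /(_ l Hl)] := seg t th; rewrite -/c dualB.
  rewrite !(valL_in _ Dt) => e1.
  have := s1 (inD Dt) (A1t t th) l Hl; rewrite dualB => e2.
  set u := l _ in e2 *; set v := l _ in e1 e2; move: e1 e2; rewrite !ler_norml.
  by move=> /andP[? ?] /andP[? ?]; apply/andP; split; lra.
have := @dquot_mvt0 R d (l \o 'valL_(0 : F) (Cl_partial (sval be) s)) i x h (l c) 2^-1.
have {}est1 t : `|t| <= `|h| -> exists2 l' : R^o,
    dquot (l \o 'valL_(0 : F) (Cl_partial (sval be) s)) i (t *: unitv i + x) @ 0^' --> l' &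
    `|l' - l c| <= 2^-1.
  move=> th; exists (l ('valL_(0 : F) (Cl_partial (sval al) s) (t *: unitv i + x))).
    apply: (dquot_comp (dual_linear l) (@dual_continuous _ _ l)).
    by apply: dquot_partial => //; exact: (seg t th).1.
  exact: est1.
move=> /(_ est1).
have := est2 h (lexx _); have := est2 0; rewrite normr0 scale0r add0r => /(_ (normr_ge0 _)).
rewrite -/a -/b /=; move: (l a) (l b) (l c) (l _) (l _) => la lb lc u v.
rewrite !ler_norml; move: `|h| => n.
by move=> /andP[? ?] /andP[? ?] /andP[? ?]; apply/andP; split; lra.
Unshelve. all: by end_near. Qed.

Let lim0 : multi_index d ell := exist _ (fun=> 0%N) (@below0 d ell).

Let lim_ipartial w al : mword (sval al) = w ->
  ipartially_derivable D° w ('valL_(0 : F) (lim lim0)) /\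
  forall x, D° x -> ipartial w ('valL_(0 : F) (lim lim0)) x = 'valL_(0 : F) (lim al) x.
Proof.
elim: w al => [|i w IH] al alw.
  (* An index with empty word is not syntactically [lim0]; both limits agree because both
     derivatives are the map itself. *)
  split => // x Dx; rewrite -[ipartial [::] _]/('valL_(0 : F) (lim lim0)) !(valL_in _ Dx).
  apply: (@cvg_unique _ (@lcs_hausdorff R F) _ _ _ _ _ (@limP al (inD Dx))).
  rewrite (_ : (fun s => _) = (fun s => Cl_partial (sval lim0) s (inD Dx))); last first.
    apply/funext => s; transitivity ('valL_(0 : F) (Cl_partial (sval al) s) x).
      by rewrite (valL_in _ Dx).
    rewrite valL_partial// alw -[LHS]/('valL_(0 : F) s x) (valL_in _ Dx).
    by rewrite Cl_partial0.
  exact: limP.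
have [be [wbe bea]] := mword_tail alw.
pose be' : multi_index d ell := exist _ be (below_le bea (svalP al)).
have [dw wE] := IH be' (esym wbe).
have cv x : D° x -> dquot (ipartial w ('valL_(0 : F) (lim lim0))) i x @ 0^' -->
    'valL_(0 : F) (lim al) x.
  move=> Dx; apply: dquot_near (@dquot_lim al be' i x Dx _); last by rewrite alw wbe.
  by apply: filterS (nbhsD Dx) => y Dy; rewrite wE.
split; last by move=> x Dx; apply: partialE; exact: cv.
by split => // x Dx; eexists; exact: cv.
Qed.

Let lim_extends al : extends_partial (sval al) (lim lim0) (lim al).
Proof.
split; first exact: lim_continuous.
by move=> x Dx; rewrite (lim_ipartial erefl).2// valL_val.
Qed.

Let lim_is_Cl : is_Cl ell (lim lim0).
Proof.
split; first exact: lim_continuous.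
move=> al b; pose al' : multi_index d ell := exist _ al b.
have [dl lE] := @lim_ipartial _ al' erefl.
split => //; last by exists (lim al'); exact: (lim_extends al').
move=> x Dx A; rewrite lE// => /(valL_continuous (@lim_continuous al') Dx) nA.
suff : \forall y \near x, A (ipartial (mword al) ('valL_(0 : F) (lim lim0)) y) by [].
by apply: filterS (filterI (nbhsD Dx) nA) => y [Dy Ay]; rewrite lE.
Qed.

Lemma cauchy_Cl_cvg : exists c : Cl ell D F, G --> c.
Proof.
exists (MkCl (introT (asboolP _) lim_is_Cl)); apply/Cl_cvgP => al K U cK U0.
rewrite (_ : Cl_partial (sval al) (MkCl _) = lim al); first exact: lim_unif.
apply: extends_unique; last exact: lim_extends.
exact: (Cl_partialP (MkCl (introT (asboolP _) lim_is_Cl)) (svalP al)).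
Qed.

End completeness.

Lemma Cl_complete (R : realType) (d : nat) (ell : option nat) (D : domain R d)
  (F : lcsType R) : lcs_complete F -> lcs_complete (Cl ell D F).
Proof. by move=> cF G PG cG; exact: cauchy_Cl_cvg. Qed.

(** * Bernstein operators *)

Section bernstein.
Context {R : realType} {d : nat}.
Variable h : R.
Local Notation unitv i := (delta_mx 0 i : 'rV[R]_d).
Implicit Types (u : 'I_d -> R) (v w : seq 'I_d) (y z : 'rV[R]_d) (i k : 'I_d).

(* De Casteljau's algorithm: for [v] containing each [i] [n] times this is the
   Bernstein polynomial of [f] on the cube with edges [n * h] at [y], at the
   point with barycentric coordinates [u]. *)
Fixpoint bern (F : lmodType R) u v (f : 'rV[R]_d -> F) y : F :=
  if v is i :: v' then
    (1 - u i) *: bern u v' f y + u i *: bern u v' f (h *: unitv i + y)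
  else f y.

Section module.
Variable F : lmodType R.
Implicit Types f g : 'rV[R]_d -> F.

Lemma bern_shift u v f z y : bern u v (fun y => f (z + y)) y = bern u v f (z + y).
Proof.
by elim: v y => //= i v IH y; rewrite !IH addrCA.
Qed.

Lemma bern_lin u v (a : R) f g y :
  bern u v (fun y => a *: f y + g y) y = a *: bern u v f y + bern u v g y.
Proof.
elim: v y => //= i v IH y; rewrite !IH !scalerDr !scalerA !(mulrC a).
by rewrite addrACA.
Qed.

Lemma bern_comp (E : lmodType R) (T : F -> E) u v f y : linear T ->
  bern u v (T \o f) y = T (bern u v f y).
Proof.
move=> lT; have T0 : T 0 = 0 by have := lT (-1) 0 0; rewrite !scaleN1r !addNr.
elim: v y => //= i v IH y; rewrite !IH lT; congr (_ + _).
by rewrite -[_ *: bern u v f _]addr0 lT T0 addr0.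
Qed.

Lemma bern_swap u v f i k y : bern u [:: i, k & v] f y = bern u [:: k, i & v] f y.
Proof.
rewrite /= !scalerDr !scalerA (addrCA (h *: unitv i)) [RHS]addrACA.
by rewrite (mulrC (u k)) (mulrC (u k) (u i)) (mulrC (1 - u k)) (mulrC (1 - u k) (u i)).
Qed.

(** Steps in different directions commute, so any letter may be moved to the front. *)
Lemma bern_rem u v f i y : i \in v -> bern u v f y = bern u (i :: rem i v) f y.
Proof.
elim: v y => // k v IH y; rewrite inE => /predU1P[->|iv].
  by rewrite /= eqxx.
case: (eqVneq k i) => [->|ki]; first by rewrite /= eqxx.
have -> : rem i (k :: v) = k :: rem i v by rewrite /= (negPf ki).
by rewrite bern_swap [LHS]/= !IH.
Qed.

End module.

Lemma bern_cst u v (c : R) y : bern u v (fun=> c : R^o) y = c.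
Proof. by elim: v y => //= i v IH y; rewrite !IH -scalerDl subrK scale1r. Qed.

Lemma bern_le u v (f g : 'rV[R]_d -> R^o) y : (forall i, 0 <= u i <= 1) ->
  (forall y, f y <= g y) -> bern u v f y <= bern u v g y.
Proof.
move=> u01 fg; elim: v y => //= i v IH y; have /andP[u0 u1] := u01 i.
by apply: lerD; apply: ler_wpM2l => //; rewrite subr_ge0.
Qed.

Lemma bern_sum u v (I : Type) (r : seq I) (f : I -> 'rV[R]_d -> R^o) y :
  bern u v (fun y => \sum_(j <- r) f j y) y = \sum_(j <- r) bern u v (f j) y.
Proof.
elim: r => [|j r IH]; first by under eq_fun do rewrite big_nil; rewrite big_nil bern_cst.
under eq_fun do rewrite big_cons -[f j _]scale1r.
by rewrite bern_lin scale1r big_cons IH.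
Qed.

(** For an exponential [f], this is the moment generating function of a binomial distribution. *)
Lemma bern_eigen u v i (f : 'rV[R]_d -> R^o) (rho : R) y :
  (forall y, f (h *: unitv i + y) = rho * f y) ->
  (forall k y, k != i -> f (h *: unitv k + y) = f y) ->
  bern u v f y = (1 - u i + u i * rho) ^+ count_mem i v * f y.
Proof.
move=> fi fk; elim: v y => [|k v IH] y; first by rewrite /= mul1r.
rewrite /= !IH; case: (eqVneq k i) => [->|ki].
  by rewrite fi add1n exprS /GRing.scale /=; ring.
by rewrite fk// add0n /GRing.scale /=; ring.
Qed.

Definition dif (F : lmodType R) i (f : 'rV[R]_d -> F) y : F :=
  h^-1 *: (f (h *: unitv i + y) - f y).

Definition difs (F : lmodType R) w (f : 'rV[R]_d -> F) := foldr (@dif F) f w.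

Lemma dif_difs (F : lmodType R) i w (f : 'rV[R]_d -> F) :
  dif i (difs w f) = difs w (dif i f).
Proof.
elim: w => //= k w <-; apply/funext => y; rewrite /dif.
rewrite -!scalerBr !opprB (addrCA (h *: unitv i)); congr (_ *: (_ *: _)).
by rewrite addrACA [- _ - _]addrC addrACA.
Qed.

(** A crude bound that also covers quotients straddling a discontinuity. With mesh proportional to
    [1 / n] it grows like the power [size w] of [n]. *)
Lemma difs_bound w (f : 'rV[R]_d -> R^o) (C : R) : 0 < h -> (forall y, `|f y| <= C) ->
  forall y, `|difs w f y| <= (2 / h) ^+ size w * C.
Proof.
move=> h0 fC; elim: w => [|i w IH] y; first by rewrite mul1r; exact: fC.
have -> : difs (i :: w) f y = (difs w f (h *: unitv i + y) - difs w f y) / h.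
  by rewrite /= /dif /GRing.scale /= mulrC.
rewrite normrM normfV (gtr0_norm h0) ler_pdivrMr//.
have -> : (2 / h) ^+ size (i :: w) * C * h = 2 * ((2 / h) ^+ size w * C).
  by rewrite [size _]/= exprS; field; rewrite gt_eqF.
by apply: (le_trans (ler_normB _ _)); rewrite mulr_natl mulr2n; apply: lerD.
Qed.

Lemma bern_dif u v i (f : 'rV[R]_d -> R^o) y :
  bern u v (dif i f) y = h^-1 * (bern u v f (h *: unitv i + y) - bern u v f y).
Proof.
rewrite (_ : dif i f = (fun y => h^-1 *: f (h *: unitv i + y) + (fun y => - h^-1 *: f y + 0) y)).
  rewrite bern_lin (bern_shift u v f) bern_lin bern_cst addr0.
  by rewrite scaleNr -scalerBr.
by apply/funext => z; rewrite /dif scalerBr addr0 scaleNr.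
Qed.

Section derivative.
Variables (kappa : R) (u : 'rV[R]_d -> 'I_d -> R).
Hypothesis u_affine : forall k x z, u (x + z) k = u z k + kappa * x 0 k.

Let coord_derive x i k : is_derive x (unitv i) (fun x => u x k : R^o) (kappa * (k == i)%:R).
Proof.
have cv : (fun h => h^-1 *: (u (h *: unitv i + x) k - u x k : R^o)) @ (0 : R)^' -->
    (kappa * (k == i)%:R : R^o).
  apply: cvg_near_cst; near=> t.
  have t0 : t != 0 by near: t; exact: nbhs_dnbhs_neq.
  by rewrite u_affine addrC addKr !mxE /= /GRing.scale /= eq_sym; field.
by split; [apply/cvg_ex; eexists; exact: cv|exact: cvg_lim cv].
Unshelve. all: by end_near. Qed.

Hypothesis h0 : h != 0.

(** The classical rule for Bernstein polynomials: the degree in direction [i] drops by one and [f]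
    becomes its forward difference quotient. The factor [h] undoes the division in [dif]. *)
Lemma bern_derive v (f : 'rV[R]_d -> R^o) y i x :
  is_derive x (unitv i) (fun x => bern (u x) v f y)
    ((count_mem i v)%:R * (kappa * h) * bern (u x) (rem i v) (dif i f) y).
Proof.
elim: v y => [|k v IH] y.
  by rewrite /= mul0r mul0r; exact: is_derive_cst.
rewrite [X in is_derive _ _ X](_ : _ =
  (fun x => bern (u x) v f y) +
  (fun x => u x k : R^o) * ((fun x => bern (u x) v f (h *: unitv k + y)) - (fun x => bern (u x) v f y))); last first.
  by apply/funext => z /=; rewrite !fctE /GRing.scale /=; ring.
have c := coord_derive x i k.
have H1 := IH y; have H2 := IH (h *: unitv k + y).
apply: is_derive_eq; rewrite !fctE /GRing.scale /=.
case: (eqVneq k i) => [->|ki].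
  rewrite mulr1 natrD mulr1n.
  have bd := bern_dif (u x) v i f y.
  have -> : bern (u x) v f (h *: unitv i + y) - bern (u x) v f y =
      h * bern (u x) v (dif i f) y by rewrite bd mulVKf.
  have [iv|iv] := boolP (i \in v); last first.
    by have /count_memPn -> := iv; ring.
  by rewrite [bern (u x) v _ y](bern_rem _ _ _ iv) /= /GRing.scale /=; ring.
by rewrite add0n /= /GRing.scale /=; ring.
Qed.

(** For [v] with [n] copies of each letter and [kappa * h = s / n], this is [s ^+ size w] times a
    product of falling factorials of [n], divided by [n ^+ size w]. *)
Fixpoint bern_coef v w : R :=
  if w is i :: w' then (count_mem i (foldr (@rem _) v w'))%:R * (kappa * h) * bern_coef v w'
  else 1.

Lemma dquotP (f : 'rV[R]_d -> R^o) i x (l : R^o) :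
  dquot f i x @ 0^' --> l <-> is_derive x (unitv i) f l.
Proof.
split=> [fl|[fx <-]]; last exact: fx.
by split; [apply/cvg_ex; exists l|exact: cvg_lim fl].
Qed.

Lemma bern_ipartial v w (f : 'rV[R]_d -> R^o) y (U : set 'rV[R]_d) :
  ipartially_derivable U w (fun x => bern (u x) v f y : R^o) /\
  ipartial w (fun x => bern (u x) v f y : R^o) =
    fun x => bern_coef v w * bern (u x) (foldr (@rem _) v w) (difs w f) y.
Proof.
elim: w => [|i w [dw wE]] /=; first by split => //; apply/funext => x; rewrite mul1r.
have cv x : dquot (fun x => bern_coef v w * bern (u x) (foldr (@rem _) v w) (difs w f) y : R^o) i x @ 0^' -->
    (bern_coef v (i :: w) * bern (u x) (rem i (foldr (@rem _) v w)) (difs (i :: w) f) y : R^o).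
  apply/dquotP; have H := bern_derive (foldr (@rem _) v w) (difs w f) y i x.
  apply: is_derive_eq; rewrite /GRing.scale /=; ring.
rewrite wE; split; last by apply/funext => x; exact/partialE/cv.
by split => // x _; eexists; exact: cv.
Qed.

Lemma bern_continuous v (f : 'rV[R]_d -> R^o) y : continuous (fun x => bern (u x) v f y : R^o).
Proof.
have cu k : continuous (fun x => u x k : R).
  have -> : (fun x => u x k) = fun x : 'rV[R]_d => u 0 k + kappa * x 0 k.
    by apply/funext => x; rewrite -[x in LHS]addr0 u_affine.
  move=> x; apply: (@continuousD R R 'rV[R]_d (fun=> u 0 k) (fun x => kappa * x 0 k)).
    exact: cst_continuous.
  apply: (@continuousM R 'rV[R]_d (fun=> kappa) (fun x => x 0 k)).
    exact: cst_continuous.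
  exact: coord_continuous.
suff c : continuous (fun x => bern (u x) v f y : R) by [].
elim: v y => [|k v IH] y; first by move=> x; exact: cst_continuous.
move=> x; apply: (@continuousD R R 'rV[R]_d (fun x => (1 - u x k) * bern (u x) v f y)
    (fun x => u x k * bern (u x) v f (h *: unitv k + y))).
  apply: (@continuousM R 'rV[R]_d (fun x => 1 - u x k)); last exact: IH.
  apply: (@continuousB R R 'rV[R]_d (fun=> 1)); [exact: cst_continuous|exact: cu].
by apply: (@continuousM R 'rV[R]_d (fun x => u x k)); [exact: cu|exact: IH].
Qed.

End derivative.

End bernstein.

(** * Mean value and Chernoff estimates *)

Section estimates.
Context {R : realType} {d : nat}.
Local Notation unitv i := (delta_mx 0 i : 'rV[R]_d).
Implicit Types (v w : seq 'I_d) (a y z : 'rV[R]_d) (i : 'I_d).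

Lemma rV_ballP a (e : R) z : ball a e z <-> 0 < e /\ forall k, `|z 0 k - a 0 k| < e.
Proof.
split=> [[e0 H]|[e0 H]]; split => //.
  by move=> k; have := H 0 k; rewrite -ball_normE /ball_ /= distrC.
by move=> i k; rewrite (ord1 i) -ball_normE /ball_ /= distrC.
Qed.

Lemma ball_unitv a z (e t h : R) i : ball a e z -> 0 <= t <= h ->
  ball a (e + h) (t *: unitv i + z).
Proof.
move=> /rV_ballP [e0 H] /andP[t0 th]; apply/rV_ballP; split; first lra.
move=> k; rewrite !mxE eqxx /= -addrA; have := H k.
case: (k == i); rewrite /= ?mulr1 ?mulr0 !ltr_norml => /andP[? ?]; apply/andP; split; lra.
Qed.

Lemma ipartial_shift (F : lcsType R) w (f : 'rV[R]_d -> F) z :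
  ipartial w (fun y => f (z + y)) = fun y => ipartial w f (z + y).
Proof.
elim: w => //= i w ->; apply/funext => y; rewrite /partial.
have -> // : dquot (fun y => ipartial w f (z + y)) i y = dquot (ipartial w f) i (z + y).
by apply/funext => h; rewrite /dquot addrCA.
Qed.

Lemma ipartially_derivable_shift (F : lcsType R) w (f : 'rV[R]_d -> F) z
    (U V : set 'rV[R]_d) : (forall y, U y -> V (z + y)) ->
  ipartially_derivable V w f -> ipartially_derivable U w (fun y => f (z + y)).
Proof.
move=> UV; elim: w => //= i w IH [/IH ? df]; split => // y /UV /df.
rewrite ipartial_shift => -[l fl]; exists l; apply: cvg_trans fl.
by apply: near_eq_cvg; near=> h; rewrite /dquot addrCA.
Unshelve. all: by end_near. Qed.

Lemma ipartially_derivable_sub (F : lcsType R) w (f : 'rV[R]_d -> F)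
    (U V : set 'rV[R]_d) : U `<=` V ->
  ipartially_derivable V w f -> ipartially_derivable U w f.
Proof. by move=> UV; elim: w => //= i w IH [/IH ? df]; split => // y /UV /df. Qed.

Lemma ipartial_eq (F : lcsType R) w (f g : 'rV[R]_d -> F) (U : set 'rV[R]_d) :
  open U -> (forall y, U y -> f y = g y) -> ipartially_derivable U w f ->
  ipartially_derivable U w g /\ forall y, U y -> ipartial w g y = ipartial w f y.
Proof.
move=> oU fg; elim: w => [_|i w IH [/IH [dg E] df]]; first by split => // y Uy; rewrite /= fg.
have cv x : U x -> dquot (ipartial w g) i x @ 0^' --> partial i (ipartial w f) x.
  move=> Ux; apply: dquot_near (partialP (df x Ux)); near=> y.
  by rewrite E//; near: y; exact: open_nbhs_nbhs.
split; first by split => // x Ux; eexists; exact: cv.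
by move=> x Ux; apply: partialE; exact: cv.
Unshelve. all: by end_near. Qed.

(** Since difference quotients commute, the outermost one is moved next to [f]. The [w]-derivative
    of [dif i f] is a quotient of [ipartial w f], which the mean value theorem keeps within the same
    [eps] of [c]; each letter only enlarges the ball by one step [h]. *)
Lemma difs_mvt w (f : 'rV[R]_d -> R^o) a (h e c eps : R) : 0 < h -> 0 < e ->
  ipartially_derivable (ball a (e + (size w)%:R * h)) w f ->
  (forall y, ball a (e + (size w)%:R * h) y -> `|ipartial w f y - c| <= eps) ->
  forall z, ball a e z -> `|difs h w f z - c| <= eps.
Proof.
move=> h0 e0; elim: w f => [|i w IH] f.
  by rewrite mul0r addr0 => _ H z /H.
have -> : e + (size (i :: w))%:R * h = e + (size w)%:R * h + h.
  by rewrite /= -addn1 natrD mulrDl mul1r addrA.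
set r := e + (size w)%:R * h => -[dw dpf] H z az.
have r0 : 0 < r by rewrite ltr_wpDr// mulr_ge0// ltW.
have sub : ball a r `<=` ball a (r + h) by apply: le_ball; lra.
have sh y : ball a r y -> ball a (r + h) (h *: unitv i + y).
  by move=> ay; apply: ball_unitv => //; rewrite lexx ltW.
have dw1 := ipartially_derivable_sub sub dw.
have dw2 := ipartially_derivable_shift sh dw.
have E : dif h i f = fun y => h^-1 *: f (h *: unitv i + y) + (- h^-1 *: f y + 0).
  by apply/funext => y; rewrite /dif scalerBr addr0 scaleNr.
have [d0 E0] := @ipartial0 R d R^o (ball a r) w.
have oB : open (ball a r) by exact: ball_open.
have [d1 E1] := ipartial_lin oB (- h^-1) dw1 d0.
have [d2 E2] := ipartial_lin oB h^-1 dw2 d1.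
rewrite -[difs h (i :: w) f]/(dif h i (difs h w f)) dif_difs.
apply: (IH _ _ _ z az); first by rewrite E.
move=> y ay; rewrite E E2// E1// E0 addr0 ipartial_shift.
have mv : `|ipartial w f (h *: unitv i + y) - ipartial w f y - h * c| <= eps * h.
  have := @dquot_mvt R d (ipartial w f) i y 0 h c eps (ltW h0).
  rewrite scale0r add0r subr0; apply => t t01.
  have by' := ball_unitv i ay t01.
  exists (partial i (ipartial w f) (t *: unitv i + y)); last exact: H.
  by apply: partialP; exact: dpf.
have -> : h^-1 *: ipartial w f (h *: unitv i + y) + - h^-1 *: ipartial w f y - c =
    (ipartial w f (h *: unitv i + y) - ipartial w f y - h * c) / h :> R.
  by rewrite /GRing.scale /=; field; rewrite gt_eqF.
by rewrite normrM normfV (gtr0_norm h0) ler_pdivrMr.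
Qed.

(** From [1 - t <= expR (- t)], together with the fact that the product of [1 - t] and the
    right-hand side is [1 + t ^+ 2 * (1 - 2 * t)]. Negative [t] is allowed, as both tails are
    needed. *)
Lemma expR_le (t : R) : t <= 2^-1 -> expR t <= 1 + t + 2 * t ^+ 2.
Proof.
move=> t2; have t1 : 0 < 1 - t by lra.
have : (1 - t) * expR t <= 1.
  have := ler_wpM2r (expR_ge0 t) (expR_ge1Dx (- t)).
  by rewrite expRN mulVf// gt_eqF// expR_gt0.
have : 1 <= (1 - t) * (1 + t + 2 * t ^+ 2).
  have : 0 <= t ^+ 2 * (1 - 2 * t) by rewrite mulr_ge0 ?sqr_ge0//; lra.
  lra.
by move=> H1 H2; rewrite -(ler_pM2l t1) (le_trans H2).
Qed.

Lemma bern_expR u v i (h s a b : R) y : s <= 2^-1 -> h != 0 -> 0 <= u i <= 1 ->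
  bern h u v (fun z => expR (s * ((z 0 i - a) / h) - b) : R^o) y <=
  expR ((count_mem i v)%:R * u i * (s + 2 * s ^+ 2) + s * ((y 0 i - a) / h) - b).
Proof.
move=> s2 h0 /andP[u0 u1].
rewrite (@bern_eigen R d h u v i _ (expR s)); last 2 first.
- move=> z; rewrite !mxE !eqxx mulr1 -expRD; congr expR.
  by field.
- move=> k z ki; rewrite !mxE eqxx /= eq_sym (negPf ki) mulr0 add0r //.
rewrite -[X in _ <= expR X]addrA [X in _ <= X]expRD ler_wpM2r ?expR_ge0//.
rewrite -mulrA expRM_natl lerXn2r ?nnegrE ?expR_ge0//.
  by rewrite addr_ge0 ?mulr_ge0 ?expR_ge0// subr_ge0.
apply: le_trans (expR_ge1Dx _).
rewrite -addrA lerD2l; have := ler_wpM2l u0 (expR_le s2).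
by lra.
Qed.

(* Chernoff's bound: the exponentials are eigenfunctions of [bern], so positivity
   controls the contribution of the nodes far from [a]. *)
Lemma bern_tail u v (g : 'rV[R]_d -> R^o) a y0 (n k : nat) (h t c eps M : R) :
  0 < h -> (0 < n)%N -> (forall i, 0 <= u i <= 1) ->
  (forall i, (count_mem i v <= n <= count_mem i v + k)%N) ->
  (forall i, a 0 i = y0 0 i + h * n%:R * u i) ->
  0 < t <= 2^-1 -> 0 <= eps -> 0 <= M ->
  (forall z, ball a (4 * t * n%:R * h) z -> `|g z - c| <= eps) ->
  (forall z, `|g z - c| <= M) ->
  `|bern h u v g y0 - c| <= eps + M * ((2 * d)%:R * expR (t * k%:R - 2 * t ^+ 2 * n%:R)).
Proof.
move=> h0 n0 u01 cnt ay /andP[t0 t2] eps0 M0 gn gM.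
pose sg (b : bool) : R := if b then t else - t.
(* One exponential for each of the [2 * d] faces of the cube of radius [4 * t * n * h]. Beyond a
   face the linear term is at least [4 * t ^+ 2 * n], so that exponential is at least 1 there. *)
pose E (p : 'I_d * bool) : 'rV[R]_d -> R^o :=
  fun z => expR (sg p.2 * ((z 0 p.1 - a 0 p.1) / h) - 4 * t ^+ 2 * n%:R).
pose S z : R^o := \sum_(p : 'I_d * bool) E p z.
have S0 z : 0 <= S z by apply: sumr_ge0 => p _; exact: expR_ge0.
have gS z : `|g z - c| <= M * S z + eps.
  have [az|naz] := pselect (ball a (4 * t * n%:R * h) z).
    by apply: (le_trans (gn z az)); rewrite lerDr mulr_ge0.
  apply: (le_trans (gM z)); rewrite -[leLHS]addr0 lerD// -[leLHS]mulr1 ler_wpM2l//.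
  have [p Ep] : exists p, 1 <= E p z.
    apply: contrapT => nE; apply: naz; apply/rV_ballP.
    have r0 : 0 < 4 * t * n%:R * h by rewrite !mulr_gt0// ltr0n.
    split => // k0; apply: contrapT => /negP; rewrite -leNgt => le.
    apply: nE; exists (k0, 0 <= z 0 k0 - a 0 k0); rewrite /E /= /sg.
    rewrite -[leLHS]expR0 ler_expR subr_ge0.
    have H : 4 * t * n%:R <= `|z 0 k0 - a 0 k0| / h by rewrite ler_pdivlMr.
    have := ler_wpM2l (ltW t0) H; case: ifPn => [z0|].
      by rewrite (ger0_norm z0); lra.
    by rewrite -ltNge => /ltr0_norm ->; lra.
  by apply: (le_trans Ep); rewrite /S (bigD1 p)//= lerDl sumr_ge0// => q _; exact: expR_ge0.
have bS : bern h u v S y0 <= (2 * d)%:R * expR (t * k%:R - 2 * t ^+ 2 * n%:R).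
  rewrite /S bern_sum; apply: (@le_trans _ _
    (\sum_(p : 'I_d * bool) expR (t * k%:R - 2 * t ^+ 2 * n%:R))); last first.
    by rewrite sumr_const card_prod card_ord card_bool mulnC -[leLHS]mulr_natl.
  apply: ler_sum => -[i b] _; rewrite /E /=.
  have s2 : sg b <= 2^-1 by rewrite /sg; case: b; lra.
  apply: (le_trans (bern_expR v _ _ _ s2 (lt0r_neq0 h0) (u01 i))).
  rewrite ler_expR ay; have /andP[c1 c2] := cnt i; have /andP[u0 u1] := u01 i.
  (* With [N] the actual degree in direction [i], the terms linear in [t] cancel up to
     [t * (n - N) * u i <= t * k]. The quadratic term is at most [2 * t ^+ 2 * n], half of what is
     subtracted. *)
  have -> : (y0 0 i - (y0 0 i + h * n%:R * u i)) / h = - (n%:R * u i).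
    by field; rewrite gt_eqF.
  have N1 : (count_mem i v)%:R <= n%:R :> R by rewrite ler_nat.
  have N2 : n%:R <= (count_mem i v)%:R + k%:R :> R by rewrite -natrD ler_nat.
  have N0 : 0 <= (count_mem i v)%:R :> R by [].
  set N : R := _%:R in N0 N1 N2 *; set m : R := n%:R in N1 N2 *.
  set K : R := k%:R in N2 *.
  have A : N * u i <= m by apply: le_trans N1; rewrite ler_piMr.
  have p0 : 0 <= (m - N) * u i by rewrite mulr_ge0// subr_ge0.
  have pk : (m - N) * u i <= K.
    by apply: (@le_trans _ _ (m - N)); [rewrite ler_piMr// subr_ge0|lra].
  have tp0 := mulr_ge0 (ltW t0) p0.
  have tpk := ler_wpM2l (ltW t0) pk.
  have tA := ler_wpM2l (sqr_ge0 t) A.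
  have tK : 0 <= t * K by rewrite mulr_ge0// ltW.
  by rewrite /sg; case: (b); lra.
have bm (s e : R) : bern h u v (fun z => s *: S z + (fun=> e : R^o) z) y0 = s * bern h u v S y0 + e.
  by rewrite bern_lin bern_cst.
have MS : M * bern h u v S y0 <= M * ((2 * d)%:R * expR (t * k%:R - 2 * t ^+ 2 * n%:R)).
  exact: ler_wpM2l.
have up : bern h u v g y0 <= M * bern h u v S y0 + (eps + c).
  rewrite -bm; apply: bern_le => // z; have := gS z.
  by rewrite ler_norml /GRing.scale /=; lra.
have lo : - M * bern h u v S y0 + (c - eps) <= bern h u v g y0.
  rewrite -bm; apply: bern_le => // z; have := gS z.
  by rewrite ler_norml /GRing.scale /=; lra.
by move: MS up lo; rewrite ler_norml; lra.
Qed.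

Lemma poly_expR_small (a eps : R) k : 0 < a -> 0 < eps ->
  \forall n \near \oo, n%:R ^+ k * expR (- (a * n%:R)) <= eps.
Proof.
move=> a0 eps0; near=> n.
have n0 : 0 < n%:R :> R.
  by rewrite ltr0n; near: n; exists 1%N.
have an0 : 0 <= a * n%:R by rewrite mulr_ge0// ltW.
have H := expR_ge1Dxn k an0; rewrite expRN ler_pdivrMr ?expR_gt0//.
have f0 : 0 < k.+1`!%:R :> R by rewrite ltr0n fact_gt0.
have ak : 0 < a ^+ k.+1 by rewrite exprn_gt0.
have nbig : k.+1`!%:R / (a ^+ k.+1 * eps) <= n%:R.
  by near: n; exact: nbhs_infty_ger.
have {}H : (a * n%:R) ^+ k.+1 / k.+1`!%:R <= expR (a * n%:R) by apply: le_trans H; rewrite lerDr.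
apply: le_trans (ler_wpM2l (ltW eps0) H).
rewrite exprMn mulrA ler_pdivlMr//.
rewrite ler_pdivrMr ?mulr_gt0// in nbig.
have := ler_wpM2l (exprn_ge0 k (ltW n0)) nbig.
by rewrite [n%:R ^+ k.+1]exprS; lra.
Unshelve. all: by end_near. Qed.

End estimates.

(** * Density of the finite-dimensional-valued maps *)

Section counting.
Variable d : nat.
Implicit Types (v w : seq 'I_d) (i : 'I_d).

Lemma count_mword (al : 'I_d -> nat) i : count_mem i (mword al) = al i.
Proof.
rewrite /mword; suff : forall l, uniq l ->
    count_mem i (flatten [seq nseq (al j) j | j <- l]) = if i \in l then al i else 0%N.
  by move=> /(_ (enum 'I_d)) ->; rewrite ?mem_enum ?enum_uniq.
elim=> //= j l IH /andP[jl /IH {}IH]; rewrite count_cat count_nseq IH in_cons /=.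
case: (eqVneq i j) => [->|ij] /=; first by rewrite (negPf jl) addn0 mul1n.
by rewrite mul0n.
Qed.

Lemma count_rems i v w :
  (count_mem i (foldr (@rem _) v w) <= count_mem i v <=
    count_mem i (foldr (@rem _) v w) + size w)%N.
Proof.
elim: w => [|k w IH] /=; first by rewrite addn0 leqnn.
have /andP[l1 l2] := IH; rewrite count_rem; set b := (k \in _) && (k == i).
apply/andP; split; first by rewrite (leq_trans _ l1)// leq_subr.
apply: (leq_trans l2); rewrite addnS -addSn leq_add2r.
by case: b => /=; rewrite ?subn0 ?subn1 ?leqSpred ?leqnSn.
Qed.

End counting.

(** After [k] deletions the next factor lies between [1 - k / n] and 1, up to [s]; the losses
    accumulate by [k ^+ 2 + k <= k.+1 ^+ 2]. *)
Lemma bern_coef_le (R : realType) (d n : nat) (h kappa s : R) (w : seq 'I_d) :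
  (0 < n)%N -> 0 <= s <= 1 -> kappa * h = s / n%:R ->
  s ^+ size w * (1 - (size w)%:R ^+ 2 / n%:R) <=
    bern_coef h kappa (mword (fun=> n)) w <= s ^+ size w /\
  0 <= bern_coef h kappa (mword (fun=> n)) w.
Proof.
move=> n0 /andP[s0 s1] kh; have n0' : 0 < n%:R :> R by rewrite ltr0n.
elim: w => [|i w [/andP[l1 l2] l0]].
  by rewrite /= expr0 expr0n /= mul0r subr0 mulr1 lexx ler01.
rewrite [bern_coef _ _ _ _]/= kh [size _]/= [s ^+ _]exprS.
set c := bern_coef _ _ _ _ in l0 l1 l2 *.
set N : nat := count_mem i _; set k := size w in l1 l2 *.
have /andP[] := count_rems i (mword (fun=> n)) w; rewrite count_mword -/N -/k => N1 N2.
have q0 : 0 <= N%:R / n%:R :> R by rewrite divr_ge0.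
have q1 : N%:R / n%:R <= 1 :> R by rewrite ler_pdivrMr// mul1r ler_nat.
have q2 : 1 - k%:R / n%:R <= N%:R / n%:R :> R.
  rewrite -[X in X - _](@divff _ n%:R) ?gt_eqF// -mulrBl ler_pM2r ?invr_gt0//.
  by rewrite lerBlDr -natrD ler_nat.
have -> : N%:R * (s / n%:R) * c = s * (N%:R / n%:R * c) by ring.
have qc : N%:R / n%:R * c <= c by rewrite ler_piMl.
split; last by rewrite !mulr_ge0.
apply/andP; split; last by rewrite ler_wpM2l// (le_trans qc).
rewrite -mulrA ler_wpM2l//.
have sk : 0 <= s ^+ k by rewrite exprn_ge0.
have H1 := ler_wpM2r l0 q2.
have kn : 0 <= k%:R / n%:R :> R by rewrite divr_ge0.
have H2 := ler_wpM2l kn l2.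
have H3 : s ^+ k * (k%:R ^+ 2 / n%:R) + k%:R / n%:R * s ^+ k <= s ^+ k * (k.+1%:R ^+ 2 / n%:R).
  rewrite [X in _ + X]mulrC -mulrDr ler_wpM2l// -mulrDl ler_pM2r ?invr_gt0//.
  have k0 : 0 <= k%:R :> R by [].
  by rewrite -natr1; lra.
by move: l1 H1 H2 H3; rewrite !mulrBr !mulrBl !mulr1 mul1r; lra.
Qed.

Section decomposition.
Context {R : realType} {d : nat}.
Local Notation unitv i := (delta_mx 0 i : 'rV[R]_d).
Implicit Types (v w : seq 'I_d) (y z : 'rV[R]_d).

Fixpoint bern_nodes (h : R) v y : seq 'rV[R]_d :=
  if v is i :: v' then bern_nodes h v' y ++ bern_nodes h v' (h *: unitv i + y)
  else [:: y].

(** Separates vectors from scalar weights: the Bernstein mean of the indicator of a node is its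
    basis polynomial, which exhibits the mean as coming from a tensor. *)
Lemma bern_decomp (F : lmodType R) (h : R) u v (f : 'rV[R]_d -> F) y (Z : seq 'rV[R]_d) :
  uniq Z -> {subset bern_nodes h v y <= Z} ->
  bern h u v f y = \sum_(z <- Z) bern h u v (fun y => (y == z)%:R : R^o) y *: f z.
Proof.
move=> uZ; elim: v y => [|i v IH] y /= sub.
  rewrite (bigD1_seq y)//= ?sub ?inE// eqxx scale1r big1 ?addr0// => z zy.
  by rewrite eq_sym (negPf zy) scale0r.
rewrite !IH; first last.
- by move=> z zv; apply: sub; rewrite mem_cat zv.
- by move=> z zv; apply: sub; rewrite mem_cat zv orbT.
rewrite !scaler_sumr -big_split /=; apply: eq_bigr => z _.
by rewrite !scalerA -scalerDl.
Qed.

End decomposition.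

Section restriction.
Context {R : realType} {d : nat} (ell : option nat) (D : domain R d) {F : lcsType R}.
Variable phi : 'rV[R]_d -> F.
Hypothesis dphi : forall w, ipartially_derivable D° w phi.
Hypothesis cphi : forall w, continuous (ipartial w phi).

Let res w (p : dom D) : F := ipartial w phi (val p).

Let res_continuous w : continuous (res w).
Proof.
move=> p A /cphi; rewrite -/(nbhs _ _) => W.
by apply/dom_nbhsP; eexists; first exact: W.
Qed.

Let phiE y : D° y -> phi y = 'valL_(0 : F) (res [::]) y.
Proof.
move=> Dy; pose p : dom D := exist _ y (mem_set (interior_subset Dy)).
by rewrite -[y in RHS]/(val p) valL_val.
Qed.

(** The derivatives of [phi] are continuous on the whole space, so their restrictions serve as the
    extensions up to the boundary. *)
Lemma restrict_extends al : extends_partial al (res [::]) (res (mword al)).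
Proof.
split; first exact: res_continuous.
move=> x Dx; have [_ E] := ipartial_eq (@open_interior _ D) phiE (dphi (mword al)).
by rewrite E.
Qed.

Lemma restrict_is_Cl : is_Cl ell (res [::]).
Proof.
split; first exact: res_continuous.
move=> al b; have [dr E] := ipartial_eq (@open_interior _ D) phiE (dphi (mword al)).
split => //; last by exists (res (mword al)); exact: restrict_extends.
move=> x Dx A; rewrite E// => /cphi nA.
suff : \forall y \near x, A (ipartial (mword al) ('valL_(0 : F) (res [::])) y) by [].
have Dn : \forall y \near x, D° y.
  by apply: open_nbhs_nbhs; split => //; exact: open_interior.
by apply: filterS (filterI Dn nA) => y [Dy Ay]; rewrite E.
Qed.

Definition restrict : Cl ell D F := MkCl (introT (asboolP _) restrict_is_Cl).

Lemma Cl_partial_restrict al : below ell al ->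
  Cl_partial al restrict = fun p => ipartial (mword al) phi (val p).
Proof.
move=> b; apply: extends_unique; first exact: (Cl_partialP restrict b).
exact: restrict_extends.
Qed.

End restriction.

(** * Maps represented by tensors *)

Section tensor_functions.
Context {R : realType} {d : nat} {ell : option nat} {D : domain R d} {F : lcsType R}.
Implicit Types (s : seq (F * Cl ell D R^o)).

Let scale_linear (y : F) : linear (fun r : R^o => r *: y).
Proof. by move=> a b c; rewrite scalerDl -scalerA. Qed.

Let scale_continuous (y : F) : continuous (fun r : R^o => r *: y).
Proof.
move=> r; exact: (@continuous2_cvg _ R^o F F (nbhs r) _ (fun m : R^o => m) (fun=> y)
  (fun (a : R^o) (z : F) => a *: z) r y (@scale_continuous R F (r, y)) (cvg_id) (cvg_cst _)).
Qed.

Definition tens_fun s : Cl ell D F :=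
  \sum_(p <- s) Cl_comp (@scale_linear p.1) (@scale_continuous p.1) p.2.

Lemma tens_funE s q : tens_fun s q = \sum_(p <- s) p.2 q *: p.1.
Proof.
rewrite /tens_fun; elim: s => [|p s IH]; first by rewrite !big_nil.
by rewrite !big_cons -IH.
Qed.

Definition dual_comp (l : dual F) : Cl ell D F -> Cl ell D R^o :=
  Cl_comp (dual_linear l) (@dual_continuous _ _ l).

Lemma dual_comp_tens s (l : dual F) : dual_comp l (tens_fun s) = eps_op s l.
Proof.
apply/val_inj/funext => q /=; rewrite tens_funE /eps_op.
elim: s => [|p s IH]; first by rewrite !big_nil dual0.
by rewrite !big_cons dualD dualZ IH mulrC.
Qed.

Lemma Cl_partial_dual al s (l : dual F) p : below ell al ->
  l (Cl_partial al (tens_fun s) p) = Cl_partial al (eps_op s l) p.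
Proof. by move=> b; rewrite -dual_comp_tens /dual_comp Cl_partial_comp. Qed.

End tensor_functions.

Lemma near_list (I T : Type) (G : set_system T) {FG : Filter G} (L : seq I)
  (P : I -> T -> Prop) : (forall i, \forall t \near G, P i t) ->
  \forall t \near G, forall i, List.In i L -> P i t.
Proof.
move=> H; elim: L => [|i L IH]; first by apply: filterE => t ? [].
by apply: filterS (filterI (H i) IH) => t [Pi PL] k [<-//|/PL].
Qed.

Lemma equicontinuous_bounded (R : realType) (F : lcsType R) (H : set (dual F)) (y : F) :
  equicontinuous_set H -> exists C : R, forall l, H l -> `|l y| <= C.
Proof.
move=> /equicontinuous_setP /(_ 1 ltr01) /(lcs_scale_cvg0 y) [e /= e0 eH].
exists (2 / e) => l Hl.
have e2 : 0 < e / 2 by rewrite divr_gt0.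
have := eH (e / 2) _ l Hl; rewrite /= sub0r normrN gtr0_norm// dualZ normrM gtr0_norm//.
have lt : e / 2 < e by lra.
move=> /(_ lt); rewrite -ler_pdivlMl// => /le_trans; apply.
by rewrite mulr1 invf_div.
Qed.

(* Contracting [D] towards an interior point [x0] moves compact subsets of [D]
   into the interior, where derivatives are controlled on neighbourhoods. *)
Section contraction.
Context {R : realType} {d : nat} {D : domain R d}.
Hypothesis D_convex : convex_set (dom D).
Variable x0 : 'rV[R]_d.
Hypothesis Dx0 : D° x0.

Definition contract (s : R) (x : 'rV[R]_d) : 'rV[R]_d := s *: x + (1 - s) *: x0.

(** The map [f] inverts the contraction centred at [x]: a point [y] near [contract s x] is a convex
    combination of [x] and [f y], and [f y] is near [x0], hence in [D]. *)
Lemma contract_interior s x : dom D x -> 0 <= s < 1 -> D° (contract s x).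
Proof.
move=> Dx /andP[s0 s1]; have s1' : 1 - s != 0 by rewrite gt_eqF// subr_gt0.
pose f y : 'rV[R]_d := (1 - s)^-1 *: (y - contract s x) + x0.
have cf : f @ contract s x --> x0.
  have : f @ contract s x --> (1 - s)^-1 *: (contract s x - contract s x) + x0.
    apply: (@cvgD _ _ _ _ (nbhs_filter (contract s x))); last exact: cvg_cst.
    apply: (@cvgZl_tmp _ _ _ _ (nbhs_filter (contract s x))).
    by apply: (@cvgB _ _ _ _ (nbhs_filter (contract s x))); [exact: cvg_id|exact: cvg_cst].
  by rewrite subrr scaler0 add0r.
apply: (@filterS _ _ (nbhs_filter (contract s x)) _ _ _ (cf _ Dx0)) => y Dy.
have -> : y = s *: x + (1 - s) *: f y.
  rewrite /f scalerDr scalerA divff// scale1r /contract.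
  by rewrite addrCA subrK.
by apply: (convex_setP D_convex Dx Dy) => //; [rewrite subr_ge0 ltW|rewrite subrKC].
Qed.

Lemma contract_nbhs (x : 'rV[R]_d) (W : set 'rV[R]_d) : nbhs x W ->
  exists A, exists B, [/\ nbhs x A, nbhs (1 : R) B &
    forall y s, A y -> B s -> W (contract s y)].
Proof.
move=> /nbhs_ballP [e /= e0 eW]; pose N := `|x0 - x| + 1.
have N0 : 0 < N by rewrite ltr_wpDl.
have e4 : 0 < e / 4 by rewrite divr_gt0.
have m0 : 0 < Num.min 1 (e / (2 * N)) by rewrite lt_min ltr01 divr_gt0// mulr_gt0.
exists (ball x (e / 4)), (ball (1 : R) (Num.min 1 (e / (2 * N)))); split; [exact: nbhsx_ballx..|].
move=> y s; rewrite -!ball_normE /ball_ /= lt_min => xy /andP[s1 sN].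
apply: eW; rewrite -ball_normE /ball_ /=.
have -> : x - contract s y = s *: (x - y) + (1 - s) *: (x - x0).
  by rewrite /contract !scalerBr addrACA -scalerDl subrKC scale1r opprD.
apply: (le_lt_trans (ler_normD _ _)); rewrite !normrZ.
have s2 : `|s| <= 2.
  rewrite -[s](subKr 1) (le_trans (ler_normB _ _))// normr1.
  by rewrite -[2](@natrD _ 1 1) lerD// ltW.
have H1 : `|s| * `|x - y| <= 2 * `|x - y| by rewrite ler_wpM2r.
have H2 : `|1 - s| * `|x - x0| <= e / (2 * N) * N.
  by apply: ler_pM => //; [exact: ltW|rewrite distrC /N lerDl].
have H3 : e / (2 * N) * N = e / 2 by field; rewrite gt_eqF.
by move: xy H1 H2; rewrite H3; lra.
Qed.

Context {ell : option nat} {F : lcsType R}.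
Variables (H : set (dual F)) (eH : equicontinuous_set H).
Variables (K : set (dom D)) (cK : compact K).

(** The factor [s ^+ k] is the one the chain rule produces for a derivative of order [k] of the
    contracted map. *)
Lemma contract_near (c : dom D -> F) (k : nat) (e : R) : continuous c -> 0 < e ->
  \forall s \near (1 : R)^'-, 0 < s < 1 /\ forall p, K p -> forall l, H l ->
    `|l (s ^+ k *: 'valL_(0 : F) c (contract s (val p)) - c p)| <= e.
Proof.
move=> cc e0.
suff : \forall s \near (1 : R)^'-, K `<=` (fun p => 0 < s < 1 -> forall l, H l ->
    `|l (s ^+ k *: 'valL_(0 : F) c (contract s (val p)) - c p)| <= e).
  move=> Hs; near=> s.
  have s01 : 0 < s < 1 by apply/andP; split; near: s; [exact: nbhs_left_gt|exact: nbhs_left_lt].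
  split => // p Kp; suff : K `<=` (fun p => 0 < s < 1 -> forall l, H l ->
    `|l (s ^+ k *: 'valL_(0 : F) c (contract s (val p)) - c p)| <= e) by apply.
  by near: s.
move/compact_near_coveringP : cK; apply => p Kp.
have e4 : 0 < e / 4 by rewrite divr_gt0.
have W4 := (equicontinuous_setP H).1 eH _ e4.
have : nbhs (c p) [set y | forall l, H l -> `|l (y - c p)| <= e / 4].
  by apply/lcs_nbhs0P; apply: filterS W4 => u /=; rewrite addrK.
move=> /cc /dom_nbhsP [W Wp WH].
have sk : (fun s : R => s ^+ k - 1) @ (1 : R) --> (0 : R).
  have : (fun s : R => s ^+ k - 1) @ (1 : R) --> (1 ^+ k - 1 : R).
    by apply: cvgB; [exact: exprn_continuous|exact: cvg_cst].
  by rewrite expr1n subrr.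
have sc := sk _ (lcs_scale_cvg0 (c p) W4).
have [A [B [Ap B1 AB]]] := contract_nbhs Wp.
exists ((set_val @^-1` (A `&` W)), (B `&` [set s | forall l, H l -> `|l ((s ^+ k - 1) *: c p)| <= e / 4])).
  split => /=; last by apply: cvg_within; exact: filterI.
  by apply/dom_nbhsP; exists (A `&` W) => //; exact: filterI.
move=> [p' s] [[Ap' Wp'] [Bs sH]]; cbv beta iota delta [fst snd].
move=> /andP[s0 s1] l Hl.
have Ds : D° (contract s (val p')).
  by apply: contract_interior; [exact: set_valP|rewrite ltW].
rewrite (valL_in _ Ds).
have H1 : `|l (c (inD Ds)) - l (c p)| <= e / 4.
  by rewrite -dualB; apply: WH => //; exact: AB.
have H2 : `|l (c p') - l (c p)| <= e / 4 by rewrite -dualB; exact: WH.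
have H3 := sH l Hl; rewrite dualZ in H3.
rewrite dualB dualZ.
have sk1 : `|s ^+ k| <= 1 by rewrite ger0_norm ?exprn_ge0 ?exprn_ile1 ?ltW.
have -> : s ^+ k * l (c (inD Ds)) - l (c p') = s ^+ k * (l (c (inD Ds)) - l (c p)) +
    (s ^+ k - 1) * l (c p) - (l (c p') - l (c p)) by ring.
have H4 : `|s ^+ k * (l (c (inD Ds)) - l (c p))| <= e / 4.
  by rewrite normrM (le_trans _ H1)// ler_piMl.
apply: (le_trans (ler_normB _ _)); have := ler_normD (s ^+ k * (l (c (inD Ds)) - l (c p))) ((s ^+ k - 1) * l (c p)).
by move: H2 H3 H4; lra.
Unshelve. all: by end_near. Qed.

End contraction.

Section compact_interior.
Context {R : realType} {d : nat} {D : domain R d} {F : lcsType R}.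
Variables (H : set (dual F)) (eH : equicontinuous_set H).
Variables (A : set 'rV[R]_d) (cA : compact A) (AD : A `<=` D°).

Lemma uniform_modulus (c : dom D -> F) (e : R) : continuous c -> 0 < e ->
  \forall r \near (0 : R)^'+, forall a, A a -> forall y, ball a r y -> D° y /\
    forall l, H l -> `|l ('valL_(0 : F) c y - 'valL_(0 : F) c a)| <= e.
Proof.
move=> cc e0; move/compact_near_coveringP : cA; apply => a0 Aa0.
have e2 : 0 < e / 2 by rewrite divr_gt0.
have W2 := (equicontinuous_setP H).1 eH _ e2.
have : nbhs ('valL_(0 : F) c a0) [set y | forall l, H l -> `|l (y - 'valL_(0 : F) c a0)| <= e / 2].
  by apply/lcs_nbhs0P; apply: filterS W2 => u /=; rewrite addrK.
move=> /(valL_continuous cc (AD Aa0)) nW.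
pose S y := D° y /\ forall l, H l ->
  `|l ('valL_(0 : F) c y - 'valL_(0 : F) c a0)| <= e / 2.
have /nbhs_ballP [b /= b0 bW] : nbhs a0 S by exact: (@filterI _ _ (nbhs_filter a0) _ _ (nbhsD (AD Aa0)) nW).
have b2 : 0 < b / 2 by rewrite divr_gt0.
exists (ball a0 (b / 2), [set r | r < b / 2]).
  by split => /=; [exact: nbhsx_ballx|exact: nbhs_right_lt].
move=> [a r] [aa0 rb]; cbv beta iota delta [fst snd] in aa0, rb |- *; move=> y ay.
have ayb : ball a (b / 2) y by apply: (le_ball (ltW rb)).
have [Dy Wy] : S y.
  by apply: bW; rewrite (splitr b); exact: ball_triangle aa0 ayb.
have [_ Wa] : S a.
  by apply: bW; apply: le_ball aa0; lra.
split => // l Hl; have := Wy l Hl; have := Wa l Hl; rewrite !dualB.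
move: (l _) (l _) (l _) => u v w; rewrite !ler_norml => /andP[? ?] /andP[? ?].
by apply/andP; split; lra.
Qed.

Lemma uniform_bound (c : dom D -> F) : continuous c ->
  \forall C \near +oo, forall a, A a -> forall l, H l -> `|l ('valL_(0 : F) c a)| <= C.
Proof.
move=> cc; move/compact_near_coveringP : cA; apply => a0 Aa0.
have W1 := (equicontinuous_setP H).1 eH _ ltr01.
have : nbhs ('valL_(0 : F) c a0) [set y | forall l, H l -> `|l (y - 'valL_(0 : F) c a0)| <= 1].
  by apply/lcs_nbhs0P; apply: filterS W1 => u /=; rewrite addrK.
move=> /(valL_continuous cc (AD Aa0)) nW.
have [C0 HC0] := equicontinuous_bounded ('valL_(0 : F) c a0) eH.
exists ((fun a => 'valL_(0 : F) c a) @^-1` [set y | forall l, H l -> `|l (y - 'valL_(0 : F) c a0)| <= 1],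
   [set C | C0 + 1 <= C]).
  by split => //=; exact: nbhs_pinfty_ge (num_real _).
move=> [a C] [aW C1]; cbv beta iota delta [fst snd] in aW, C1 |- *; move=> l Hl; have := aW l Hl; have := HC0 l Hl; rewrite !dualB.
move: (C1 : C0 + 1 <= C) => {}C1; move: (l _) (l _) => u v; rewrite !ler_norml => /andP[? ?] /andP[? ?].
by apply/andP; split; lra.
Qed.

Lemma compact_coord_bound : \forall C \near +oo, forall a : 'rV[R]_d, A a -> forall i, `|a 0 i| <= C.
Proof.
move/compact_near_coveringP : cA; apply => a0 Aa0.
exists (ball a0 1, [set C | \sum_i `|a0 0 i| + 1 <= C]).
  by split => /=; [exact: nbhsx_ballx|exact: nbhs_pinfty_ge (num_real _)].
move=> [a C] [/= /rV_ballP [_ aa0] C1] i; have := aa0 i.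
have : `|a0 0 i| <= \sum_i `|a0 0 i|.
  by rewrite (bigD1 i)//= lerDl sumr_ge0.
have := ler_normD (a 0 i - a0 0 i) (a0 0 i); rewrite subrK.
by move: C1; lra.
Qed.

End compact_interior.

(** * Bernstein approximation of the contracted map *)

Section density.
Context {R : realType} {d : nat} {ell : option nat} {D : domain R d} {F : lcsType R}.
Hypothesis D_convex : convex_set (dom D).
Variables (gam : Cl ell D F) (x0 : 'rV[R]_d) (Dx0 : D° x0).
Variables (H : set (dual F)) (eH : equicontinuous_set H).
Variables (K : set (dom D)) (cK : compact K).
Variables (s : R) (s01 : 0 < s < 1).
Implicit Types (al : multi_index d ell) (w : seq 'I_d) (l : dual F).

Let A : set 'rV[R]_d := (fun p => contract x0 s (val p)) @` K.

Lemma contract_compact : compact A.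
Proof.
apply: continuous_compact => //; apply: continuous_subspaceT => p B Bp.
apply/dom_nbhsP; exists (contract x0 s @^-1` B) => //.
have cc : continuous (contract x0 s).
  move=> y; apply: (@continuousD R 'rV[R]_d 'rV[R]_d (fun y => s *: y) (fun=> (1 - s) *: x0)).
    exact: scaler_continuous.
  exact: cst_continuous.
exact: (cc (val p) B Bp).
Qed.

Lemma contract_sub_interior : A `<=` D°.
Proof.
move=> _ [p _ <-]; apply: contract_interior => //; first exact: set_valP.
by case/andP: s01 => /ltW -> ->.
Qed.

Variables (r C omega : R).
Hypotheses (r0 : 0 < r) (C0 : 0 <= C) (omega0 : 0 < omega).
Hypothesis gam_near : forall a, A a -> forall y, ball a r y -> D° y /\
  forall l, H l -> `|l ('valL_(0 : F) gam y - 'valL_(0 : F) gam a)| <= 1.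
Hypothesis gam_bound : forall a, A a -> forall l, H l -> `|l ('valL_(0 : F) gam a)| <= C.
Hypothesis A_bound : forall a : 'rV[R]_d, A a -> forall i, `|a 0 i| <= omega.

(* Only the values of [gam] near the compact subset [A] of the interior are
   used, so that [gam] need not be extended to a cube. *)
Let trunc (z : 'rV[R]_d) : F :=
  if `[< exists2 a, A a & ball a r z >] then 'valL_(0 : F) gam z else 0.

Let trunc_near a y : A a -> ball a r y -> trunc y = 'valL_(0 : F) gam y.
Proof. by move=> Aa ay; rewrite /trunc asboolT//; exists a. Qed.

Let trunc_bound l y : H l -> `|l (trunc y)| <= C + 1.
Proof.
move=> Hl; rewrite /trunc; case: asboolP => [[a Aa ay]|_]; last first.
  by rewrite dual0 normr0 addr_ge0.
have := (gam_near Aa ay).2 l Hl; have := gam_bound Aa Hl; rewrite dualB.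
have := ler_normD (l ('valL_(0 : F) gam y) - l ('valL_(0 : F) gam a)) (l ('valL_(0 : F) gam a)).
by rewrite subrK; lra.
Qed.

Let trunc_ipartial al l a : A a ->
  ipartially_derivable (ball a r) (mword (sval al)) (l \o trunc) /\
  forall y, ball a r y -> ipartial (mword (sval al)) (l \o trunc) y =
    l ('valL_(0 : F) (Cl_partial (sval al) gam) y).
Proof.
move=> Aa; have /asboolP [_ /(_ _ (svalP al)) [dg _ _]] := Cl_funP gam.
have oB : open (ball a r) by exact: ball_open.
have sub : ball a r `<=` D° by move=> y /(gam_near Aa) [].
have [dl lE] := ipartial_comp (dual_linear l) (@dual_continuous _ _ l) oB (ipartially_derivable_sub sub dg).
have eq y : ball a r y -> (l \o 'valL_(0 : F) gam) y = (l \o trunc) y.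
  by move=> ay; rewrite [RHS]/comp (trunc_near Aa ay).
have [dt tE] := ipartial_eq oB eq dl; split => // y ay.
by rewrite tE// lE// valL_partial//; exact: sub.
Qed.

(** The cube has edge [Omega], is centred at 0 and contains [A]; [y0] is its lowest corner and [h n]
    the mesh. Since [u x] gives the relative coordinates of [contract x0 s x], the contraction is
    built into the polynomial and the slope is [s / Omega]. *)
Let Omega := 2 * omega.
Let u (x : 'rV[R]_d) (i : 'I_d) : R := (contract x0 s x 0 i + omega) / Omega.
Let y0 : 'rV[R]_d := const_mx (- omega).
Let h (n : nat) : R := Omega / n%:R.

Let Omega0 : 0 < Omega. Proof. by rewrite mulr_gt0. Qed.

Let u_affine k (x z : 'rV[R]_d) : u (x + z) k = u z k + s / Omega * x 0 k.
Proof. by rewrite /u !mxE; field; rewrite gt_eqF. Qed.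

Let bern_phi n (f : 'rV[R]_d -> R^o) (x : 'rV[R]_d) : R^o :=
  bern (h n) (u x) (mword (fun=> n)) f y0.

Let h0 n : (0 < n)%N -> 0 < h n.
Proof. by move=> n0; rewrite divr_gt0// ltr0n. Qed.

Section degree.
Variables (n : nat) (n0 : (0 < n)%N).

Let hn0 : h n != 0. Proof. by rewrite gt_eqF// h0. Qed.

Let bern_phi_derivable f w : ipartially_derivable D° w (bern_phi n f).
Proof. exact: (bern_ipartial u_affine hn0 (mword (fun=> n)) w f y0 D°).1. Qed.

Let bern_phiE f w : ipartial w (bern_phi n f) =
  fun x => bern_coef (h n) (s / Omega) (mword (fun=> n)) w *
    bern (h n) (u x) (foldr (@rem _) (mword (fun=> n)) w) (difs (h n) w f) y0.
Proof. exact: (bern_ipartial u_affine hn0 (mword (fun=> n)) w f y0 D°).2. Qed.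

Let bern_phi_continuous f w : continuous (ipartial w (bern_phi n f)).
Proof.
rewrite bern_phiE => x.
have c1 := @cst_continuous 'rV[R]_d R
  (bern_coef (h n) (s / Omega) (mword (fun=> n)) w) x.
have c2 : {for x, continuous (fun x : 'rV[R]_d => bern (h n) (u x)
    (foldr (@rem _) (mword (fun=> n)) w) (difs (h n) w f) y0 : R)}.
  exact: (bern_continuous u_affine).
have c3 := continuousM c1 c2.
exact: c3.
Qed.

Let bern_Cl f : Cl ell D R^o :=
  restrict ell (bern_phi_derivable f) (@bern_phi_continuous f).

(** The node list repeats a node once per path reaching it, while the mean of its indicator already
    collects all these paths; hence [undup]. *)
Definition bern_approx : seq (F * Cl ell D R^o) :=
  [seq (trunc z, bern_Cl (fun y => (y == z)%:R)) |
    z <- undup (bern_nodes (h n) (mword (fun=> n)) y0)].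

Let dual_approx l : dual_comp l (tens_fun bern_approx) = bern_Cl (l \o trunc).
Proof.
apply/val_inj/funext => p.
rewrite -[LHS]/(l (tens_fun bern_approx p)) -[RHS]/(bern_phi n (l \o trunc) (val p)).
rewrite /bern_phi (bern_comp _ _ _ _ _ (dual_linear l)); congr (l _).
rewrite tens_funE big_map (@bern_decomp _ _ _ _ _ _ _ _
  (undup (bern_nodes (h n) (mword (fun=> n)) y0)))//; first exact: undup_uniq.
by move=> z; rewrite mem_undup.
Qed.

Lemma dual_partial_approx al l p :
  l (Cl_partial (sval al) (tens_fun bern_approx) p) =
  bern_coef (h n) (s / Omega) (mword (fun=> n)) (mword (sval al)) *
    bern (h n) (u (val p)) (foldr (@rem _) (mword (fun=> n)) (mword (sval al)))
      (difs (h n) (mword (sval al)) (l \o trunc)) y0.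
Proof.
transitivity (Cl_partial (sval al) (dual_comp l (tens_fun bern_approx)) p).
  by rewrite /dual_comp Cl_partial_comp//; exact: svalP.
rewrite dual_approx Cl_partial_restrict; last exact: svalP.
by rewrite bern_phiE.
Qed.

(** Quotients at nodes within [4 * t * Omega] reach at most [k] steps further, hence stay in the
    ball of radius [r] where the cut is invisible and [difs_mvt] applies. At the other nodes only
    the crude bound on the quotients, plus [C] for the target, is available. *)
Lemma bern_partial_bound al l p (t : R) (k := size (mword (sval al))) : K p -> H l ->
  (forall a, A a -> forall y, ball a r y -> forall l, H l ->
     `|l ('valL_(0 : F) (Cl_partial (sval al) gam) y -
          'valL_(0 : F) (Cl_partial (sval al) gam) a)| <= 4^-1) ->
  (forall a, A a -> forall l, H l -> `|l ('valL_(0 : F) (Cl_partial (sval al) gam) a)| <= C) ->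
  0 < t <= 2^-1 -> 4 * t * Omega + k%:R * h n <= r ->
  `|bern (h n) (u (val p)) (foldr (@rem _) (mword (fun=> n)) (mword (sval al)))
      (difs (h n) (mword (sval al)) (l \o trunc)) y0 -
    l ('valL_(0 : F) (Cl_partial (sval al) gam) (contract x0 s (val p)))| <=
  4^-1 + ((2 / h n) ^+ k * (C + 1) + C) *
    ((2 * d)%:R * expR (t * k%:R - 2 * t ^+ 2 * n%:R)).
Proof.
move=> Kp Hl modulus bound t12 tr.
have Aa : A (contract x0 s (val p)) by exists p.
set a := contract x0 s (val p) in Aa *.
have n0' : 0 < n%:R :> R by rewrite ltr0n.
have hn := h0 n0.
have t0 : 0 < t by case/andP: t12.
have dt0 : 0 < 4 * t * Omega by rewrite !mulr_gt0.
have hO : 4 * t * n%:R * h n = 4 * t * Omega by rewrite /h; field; rewrite gt_eqF.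
have sub : ball a (4 * t * Omega + k%:R * h n) `<=` ball a r by exact: le_ball.
have [dl lE] := trunc_ipartial al l Aa.
apply: (@bern_tail R d _ _ _ a) => //.
- move=> i; have := A_bound Aa i; rewrite ler_norml => /andP[? ?].
  rewrite /u -/a; apply/andP; split; first by apply: divr_ge0; [lra|exact: ltW].
  by rewrite ler_pdivrMr// mul1r /Omega; lra.
- move=> i; have := count_rems i (mword (fun=> n)) (mword (sval al)).
  by rewrite count_mword => /andP[-> ->].
- move=> i; rewrite [y0 _ _]mxE /u -/a /h; move: (a 0 i) => ai.
  by field; rewrite !gt_eqF.
- by rewrite addr_ge0// mulr_ge0 ?addr_ge0// exprn_ge0// divr_ge0// ltW.
- rewrite hO; apply: difs_mvt => //; first exact: (ipartially_derivable_sub sub).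
  move=> y /sub ay; rewrite lE// -dualB.
  exact: modulus.
- move=> z; apply: (le_trans (ler_normB _ _)); apply: lerD; last exact: bound.
  by apply: difs_bound => // y; exact: trunc_bound.
Qed.

End degree.

End density.

Lemma tail_small (R : realType) (k : nat) (a1 a2 t e : R) : 0 <= a1 -> 0 <= a2 -> 0 < t -> 0 < e ->
  \forall n \near \oo, (a1 * n%:R ^+ k + a2) * expR (- (2 * t ^+ 2 * n%:R)) <= e.
Proof.
move=> a10 a20 t0 e0.
have c0 : 0 < 2 * t ^+ 2 by rewrite mulr_gt0// exprn_gt0.
pose e' := e / (a1 + a2 + 1).
have e'0 : 0 < e' by rewrite divr_gt0//; lra.
near=> n.
have H1 : n%:R ^+ k * expR (- (2 * t ^+ 2 * n%:R)) <= e'.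
  by near: n; exact: poly_expR_small.
have H2 : n%:R ^+ 0 * expR (- (2 * t ^+ 2 * n%:R)) <= e'.
  by near: n; exact: poly_expR_small.
rewrite expr0 mul1r in H2.
have := ler_wpM2l a10 H1; have := ler_wpM2l a20 H2; have := weight_le a10 a20 e0.
by rewrite -/e' mulrDl; lra.
Unshelve. all: by end_near. Qed.

Lemma tens_dense (R : realType) (d : nat) (ell : option nat) (D : domain R d)
  (F : lcsType R) (D_convex : convex_set (dom D)) (gam : Cl ell D F)
  (L : seq (multi_index d ell)) (K : set (dom D)) (U : set F) :
  compact K -> nbhs 0 U -> exists s : seq (F * Cl ell D R^o), Cl_ball L K U gam (tens_fun s).
Proof.
move=> cK U0.
have [[x0 Dx0]|nD] := pselect (exists x, D° x); last first.
  (* Density of the interior makes [D] empty here, so the condition on points [p] is vacuous. *)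
  exists [::] => al p; exfalso; apply: nD.
  have [x [Dx _]] := dom_dense (set_valP p) filterT.
  by exists x.
have [H eH HU] := lcs_polar U0.
pose al0 : multi_index d ell := exist _ _ (@below0 d ell).
(* The map itself must be controlled even if order 0 is not in [L], since the truncation is bounded
   through it. *)
pose L' := al0 :: L.
have e4 : 0 < 4^-1 :> R by [].
have cont (al : multi_index d ell) : continuous (Cl_partial (sval al) gam).
  by have [] := Cl_partialP gam (svalP al).
have [s Hs] := filter_ex (near_list L' (fun al =>
  contract_near D_convex Dx0 eH cK (size (mword (sval al))) (cont al) e4)).
have [s01 _] := Hs al0 (or_introl erefl).
have cA := @contract_compact _ _ _ x0 _ cK s.
have AD := contract_sub_interior D_convex Dx0 s01 (K := K).
set A : set 'rV[R]_d := _ @` K in cA AD.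
have [r [r0 Hr]] := filter_ex (filterI (nbhs_right_gt (0 : R))
  (near_list L' (fun al => uniform_modulus eH cA AD (cont al) e4))).
have [C [C0 HC]] := filter_ex (filterI (nbhs_pinfty_ge (num_real (0 : R)))
  (near_list L' (fun al => uniform_bound eH cA AD (cont al)))).
have [omega [omega0 Ho]] := filter_ex (filterI (nbhs_pinfty_gt (num_real (0 : R)))
  (compact_coord_bound cA)).
have g0 : Cl_partial (sval al0) gam = gam by exact: Cl_partial0.
have near1 a : A a -> forall y, ball a r y -> D° y /\
    forall l, H l -> `|l ('valL_(0 : F) gam y - 'valL_(0 : F) gam a)| <= 1.
  move=> Aa y ay; have [Dy Hy] := Hr al0 (or_introl erefl) a Aa y ay.
  split => // l Hl; have := Hy l Hl; rewrite g0 => /le_trans; apply.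
  by rewrite invf_le1// ler1n.
have bound1 a : A a -> forall l, H l -> `|l ('valL_(0 : F) gam a)| <= C.
  by have := HC al0 (or_introl erefl) a; rewrite g0.
pose Omega := 2 * omega.
have Omega0 : 0 < Omega by rewrite mulr_gt0.
(* This uses half of [r] for the near nodes; the other half is left for the steps of the difference
   quotients. *)
pose t := Num.min 2^-1 (r / (8 * Omega)).
have t0 : 0 < t by rewrite lt_min invr_gt0 ltr0n /= divr_gt0// mulr_gt0.
have t2 : t <= 2^-1 by rewrite ge_min lexx.
have tr : 4 * t * Omega <= r / 2.
  have : t <= r / (8 * Omega) by rewrite ge_min lexx orbT.
  by rewrite ler_pdivlMr ?mulr_gt0//; lra.
have near_n : \forall n \near \oo, forall al, List.In al L' ->
    [/\ (size (mword (sval al)))%:R * (Omega / n%:R) <= r / 2,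
        (size (mword (sval al)))%:R ^+ 2 / n%:R * (C + 1) <= 4^-1 &
        ((2 / (Omega / n%:R)) ^+ size (mword (sval al)) * (C + 1) + C) *
        ((2 * d)%:R * expR (t * (size (mword (sval al)))%:R - 2 * t ^+ 2 * n%:R)) <= 4^-1].
  apply: near_list => al; set k := size _.
  pose b := (2 * d)%:R * expR (t * k%:R) : R.
  have b0 : 0 <= b by rewrite mulr_ge0// expR_ge0.
  have C1 : 0 <= C + 1 by rewrite addr_ge0.
  have a10 : 0 <= (2 / Omega) ^+ k * (C + 1) * b.
    by rewrite !mulr_ge0// exprn_ge0// divr_ge0// ltW.
  have a20 : 0 <= C * b by rewrite mulr_ge0.
  near=> n.
  have n0 : 0 < n%:R :> R by rewrite ltr0n; near: n; exists 1%N.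
  have n1 : k%:R * Omega / (r / 2) <= n%:R by near: n; exact: nbhs_infty_ger.
  have n2 : k%:R ^+ 2 * (C + 1) / 4^-1 <= n%:R by near: n; exact: nbhs_infty_ger.
  have n3 : ((2 / Omega) ^+ k * (C + 1) * b * n%:R ^+ k + C * b) *
      expR (- (2 * t ^+ 2 * n%:R)) <= 4^-1 by near: n; exact: tail_small.
  split.
  - rewrite ler_pdivrMr ?divr_gt0// in n1.
    by rewrite mulrA ler_pdivrMr//; lra.
  - rewrite ler_pdivrMr// in n2.
    by rewrite mulrAC ler_pdivrMr//; lra.
  - apply: le_trans n3; rewrite expRD le_eqVlt; apply/orP; left; apply/eqP.
    have -> : 2 / (Omega / n%:R) = 2 / Omega * n%:R :> R by field; rewrite !gt_eqF.
    by rewrite exprMn /b; ring.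
have n_gt0 : \forall n \near \oo, (0 < n)%N by exists 1%N.
have [n [n0 Hn]] := filter_ex (filterI n_gt0 near_n).
exists (bern_approx gam x0 K s r omega0 n0) => al p aL Kp.
have aL' : List.In al L' by right.
have n0' : 0 < n%:R :> R by rewrite ltr0n.
have [h1 h2 h3] := Hn al aL'.
apply: HU => l Hl; rewrite dualB dual_partial_approx.
have modulus a : A a -> forall y, ball a r y -> forall l, H l ->
    `|l ('valL_(0 : F) (Cl_partial (sval al) gam) y -
         'valL_(0 : F) (Cl_partial (sval al) gam) a)| <= 4^-1.
  by move=> Aa y ay; exact: (Hr al aL' a Aa y ay).2.
have t02 : 0 < t <= 2^-1 by rewrite t0 t2.
have tr' : 4 * t * Omega + (size (mword (sval al)))%:R * (Omega / n%:R) <= r by lra.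
have := bern_partial_bound C0 omega0 near1 bound1 Ho n0 Kp Hl modulus (HC al aL') t02 tr'.
have kh : s / Omega * (Omega / n%:R) = s / n%:R by field; rewrite !gt_eqF.
have s01' : 0 <= s <= 1 by case/andP: s01 => /ltW -> /ltW ->.
have [cf _] := bern_coef_le (mword (sval al)) n0 s01' kh.
set B := bern _ _ _ _ _; set cf0 := bern_coef _ _ _ _ in cf *.
rewrite -/cf0; set k := size _ in cf h1 h2 h3 * => HB.
have Ca := HC al aL' (contract x0 s (val p)) (ex_intro2 _ _ p Kp erefl) l Hl.
have [_ /(_ p Kp l Hl)] := Hs al aL'; rewrite -/k dualB dualZ => Hc.
set c := l _ in HB Ca Hc; set c' := l _ in Hc *.
have {}HB : `|B - c| <= 2^-1.
  by apply: (le_trans HB); move: h3; lra.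
have sk1 : s ^+ k <= 1 by case/andP: s01 => s0 s1; rewrite exprn_ile1 ?ltW.
have sk0 : 0 <= s ^+ k by case/andP: s01 => s0 s1; rewrite exprn_ge0 ?ltW.
have kn : 0 <= k%:R ^+ 2 / n%:R :> R by rewrite divr_ge0// exprn_ge0.
have Hcf : `|cf0 - s ^+ k| <= k%:R ^+ 2 / n%:R.
  case/andP: cf => l1 l2; rewrite ler0_norm ?subr_le0// opprB.
  have := ler_piMl kn sk1; move: l1; rewrite mulrBr mulr1; lra.
have BC : `|B| <= C + 1.
  have := ler_normD (B - c) c; rewrite subrK.
  by move: HB Ca; lra.
(* The budget: a quarter for the coefficient, a half for the Bernstein mean (modulus of continuity
   and tail), a quarter for the contraction. *)
have -> : cf0 * B - c' = (cf0 - s ^+ k) * B + s ^+ k * (B - c) + (s ^+ k * c - c') by ring.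
have H1 : `|(cf0 - s ^+ k) * B| <= 4^-1.
  by rewrite normrM (le_trans _ h2)// ler_pM.
have H2 : `|s ^+ k * (B - c)| <= 2^-1.
  by rewrite normrM (ger0_norm sk0) (le_trans _ HB)// ler_piMl.
apply: (le_trans (ler_normD _ _)); have := ler_normD ((cf0 - s ^+ k) * B) (s ^+ k * (B - c)).
by move: H1 H2 Hc; lra.
Unshelve. all: by end_near. Qed.

(** * Uniqueness of completions and the epsilon-topology *)

Section extension.
Context {R : realType} {T : lmodType R} {E G : lcsType R}.
Variables (j : T -> E) (i : T -> G) (lj : linear j) (li : linear i).
Hypothesis G_complete : lcs_complete G.
Hypothesis dense_j : forall (c : E) (A : set E), nbhs c A -> exists t, A (j t).
Hypothesis cont_ij : forall W : set G, nbhs 0 W ->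
  exists2 V : set E, nbhs 0 V & forall t, V (j t) -> W (i t).

Let lin0 (E' : lmodType R) (k : T -> E') : linear k -> k 0 = 0.
Proof. by move=> lk; have := lk (-1) 0 0; rewrite !scaleN1r !addNr. Qed.

Let linB (E' : lmodType R) (k : T -> E') x y : linear k -> k (x - y) = k x - k y.
Proof. by move=> lk; rewrite addrC -scaleN1r lk scaleN1r addrC. Qed.

Let nbhs_sub (E' : lcsType R) (c : E') (P : set E') : nbhs 0 P -> nbhs c [set x | P (x - c)].
Proof. by move=> P0; apply/lcs_nbhs0P; apply: filterS P0 => u /=; rewrite addrK. Qed.

(** The graph of the extension, as a limit condition: [i t] tends to [y] as [j t] tends to [c]. *)
Definition ext_rel (c : E) (y : G) := forall W : set G, nbhs 0 W ->
  exists2 V : set E, nbhs c V & forall t, V (j t) -> W (i t - y).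

Let ext_rel_ex c : exists y, ext_rel c y.
Proof.
pose Fc := filter_from (nbhs c) (fun A => i @` (j @^-1` A)).
have FF : ProperFilter Fc.
  apply: filter_from_proper; last first.
    by move=> A /dense_j [t At]; exists (i t), t.
  apply: filter_from_filter; first by exists setT; exact: filterT.
  move=> A B cA cB; exists (A `&` B); first exact: filterI.
  by move=> _ [t [At Bt] <-]; split; exists t.
have [] := G_complete FF.
  move=> S; rewrite lcs_entourageE => -[W W0 WS].
  have [V V0 VW] := cont_ij W0.
  have [P P0 PV] := lcs_split V0.
  pose Q := P `&` [set u | P (- u)].
  have Q0 : nbhs 0 Q by apply: filterI => //; exact: lcs_nbhs0N.
  pose B := i @` (j @^-1` [set x | Q (x - c)]).
  have FB : Fc B by exists [set x | Q (x - c)] => //; exact: nbhs_sub.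
  exists (B, B) => // -[_ _] [/= [t [tP _] <-] [s [_ sN] <-]].
  apply: WS => /=; rewrite -(linB _ _ li); apply: VW.
  by rewrite (linB _ _ lj) -(subrK c (j t)) -addrA; apply: PV => //; rewrite -opprB.
move=> y Fy; exists y => W /(nbhs_sub y) /Fy [V Vc VW]; exists V => // t Vt.
by apply: VW; exists t.
Qed.

Let ext_rel_lin a c y c' y' : ext_rel c y -> ext_rel c' y' ->
  ext_rel (a *: c + c') (a *: y + y').
Proof.
move=> cy cy' W W0.
have [W1 W10 W1W] := lcs_split W0; have [W2 W20 W2W] := lcs_split W10.
have [V0 V00 V0W] := cont_ij W10.
have [P P0 PV] := lcs_split V00; have [Q Q0 QP] := lcs_split P0.
have [V1 V1c V1W] := cy _ (lcs_nbhs0Z a W20).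
have [V2 V2c V2W] := cy' _ W20.
(* [t1] and [t2] are good approximants on both sides at once; the remainder [t - (a *: t1 + t2)] is
   small under [j], hence under [i] by [cont_ij]. *)
have [t1 [V1t Qt1]] := dense_j (filterI V1c (nbhs_sub c (lcs_nbhs0Z (- a) Q0))).
have [t2 [V2t Qt2]] := dense_j (filterI V2c (nbhs_sub c' (lcs_nbhs0N Q0))).
exists [set x | P (x - (a *: c + c'))]; first exact: nbhs_sub.
move=> t Pt.
have -> : i t - (a *: y + y') =
    i (t - (a *: t1 + t2)) + (a *: (i t1 - y) + (i t2 - y')).
  rewrite (linB _ _ li) li scalerBr (addrACA (a *: i t1)) -opprD.
  by rewrite addrA subrK.
apply: W1W; last by apply: W2W; [exact: V1W|exact: V2W].
apply: V0W; rewrite (linB _ _ lj) lj.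
have -> : j t - (a *: j t1 + j t2) =
    (j t - (a *: c + c')) + (- a *: (j t1 - c) - (j t2 - c')).
  by rewrite scaleNr -opprD scalerBr (addrACA (a *: j t1)) -opprD opprB addrA subrK.
by apply: PV => //; exact: QP.
Qed.

Let ext_rel_j t : ext_rel (j t) (i t).
Proof.
move=> W /cont_ij [V V0 VW]; exists [set x | V (x - j t)]; first exact: nbhs_sub.
by move=> s /=; rewrite -(linB _ _ lj) -(linB _ _ li); exact: VW.
Qed.

Let ext_rel_small (W : set G) : nbhs 0 W ->
  exists2 V : set E, nbhs 0 V & forall c y, V c -> ext_rel c y -> W y.
Proof.
move=> /lcs_split [W1 W10 W1W].
have [V V0 VW] := cont_ij W10; exists V°; first exact: nbhs_interior.
move=> c y Vc /(_ _ (lcs_nbhs0N W10)) [V' V'c V'W].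
have [t [Vt V't]] := dense_j (filterI Vc V'c).
rewrite -(subrKC (i t) y); apply: W1W; first exact: VW.
by have := V'W t V't; rewrite /= opprB.
Qed.

Lemma hausdorff_eq0 (E' : lcsType R) (y : E') : (forall W : set E', nbhs 0 W -> W y) -> y = 0.
Proof.
move=> H; apply: (@lcs_hausdorff R E') => A B Ay B0.
by exists y; split; [exact: nbhs_singleton|exact: H].
Qed.

Let ext_rel_uniq c y y' : ext_rel c y -> ext_rel c y' -> y = y'.
Proof.
move=> cy cy'; apply/eqP; rewrite -subr_eq0; apply/eqP/hausdorff_eq0 => W W0.
have [V V0 VW] := ext_rel_small W0; apply: (VW 0); first exact: nbhs_singleton.
have := ext_rel_lin (-1) cy' cy.
by rewrite !scaleN1r addNr [- y' + y]addrC.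
Qed.

Lemma dense_extension : exists f : E -> G,
  [/\ linear f, continuous f & forall t, f (j t) = i t].
Proof.
have [f fP] := choice ext_rel_ex; exists f.
have lf : linear f.
  by move=> a x y; apply: (ext_rel_uniq (fP _)); exact: ext_rel_lin.
split => //; last by move=> t; apply: (ext_rel_uniq (fP _)); exact: ext_rel_j.
move=> x A /lcs_nbhs0P /ext_rel_small [V V0 VA].
have := nbhs_sub x V0; apply: filterS => y Vy.
have := VA _ _ Vy (fP _); rewrite /= [y - x]addrC -scaleN1r lf scaleN1r.
by rewrite addrAC addNr add0r.
Qed.

End extension.

Lemma dense_id (R : realType) (T : Type) (E : lcsType R) (j : T -> E) (h : E -> E) :
  (forall (c : E) (A : set E), nbhs c A -> exists t, A (j t)) ->
  continuous h -> (forall t, h (j t) = j t) -> forall c, h c = c.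
Proof.
move=> dj ch hj c; apply: (@lcs_hausdorff R E) => A B Ah Bc.
have [t [At Bt]] := dj c _ (@filterI _ _ (nbhs_filter c) _ _ (ch c _ Ah) Bc).
by exists (j t); split => //; rewrite -hj.
Qed.

Lemma completion_unique (R : realType) (T : lmodType R) (E G : lcsType R)
  (j : T -> E) (i : T -> G) :
  linear j -> linear i -> lcs_complete E -> lcs_complete G ->
  (forall (c : E) (A : set E), nbhs c A -> exists t, A (j t)) ->
  (forall (c : G) (A : set G), nbhs c A -> exists t, A (i t)) ->
  (forall W : set G, nbhs 0 W -> exists2 V : set E, nbhs 0 V & forall t, V (j t) -> W (i t)) ->
  (forall V : set E, nbhs 0 V -> exists2 W : set G, nbhs 0 W & forall t, W (i t) -> V (j t)) ->
  lcs_iso E G.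
Proof.
move=> lj li cE cG dj di ij ji.
have [f [lf cf fj]] := dense_extension lj li cG dj ij.
have [g [lg cg gi]] := dense_extension li lj cE di ji.
pose f' : {linear E -> G} := HB.pack f (GRing.isLinear.Build R E G *:%R f lf).
pose g' : {linear G -> E} := HB.pack g (GRing.isLinear.Build R G E *:%R g lg).
exists f', g'; split => //.
- apply: (dense_id dj (h := g \o f)) => [x|t]; last by rewrite /= fj gi.
  by apply: continuous_comp; [exact: cf|exact: cg].
- apply: (dense_id di (h := f \o g)) => [x|t]; last by rewrite /= gi fj.
  by apply: continuous_comp; [exact: cg|exact: cf].
Qed.

(** * The epsilon-topology as the topology induced by [C^l(D, F)] *)

Section embedding.
Context {R : realType} {d : nat} {ell : option nat} {D : domain R d} {F : lcsType R}.
Local Notation CR := (Cl ell D R^o).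

Lemma dual_separates (x y : F) : (forall l : dual F, l x = l y) -> x = y.
Proof.
move=> H; apply/eqP; rewrite -subr_eq0; apply/eqP/hausdorff_eq0 => W /lcs_polar [S _ SW].
by apply: SW => l _; rewrite dualB H subrr normr0.
Qed.

(** Functionals separate points of [F], so the claim reduces to the already known invariance of
    [eps_op]. *)
Lemma tens_fun_teq (s t : seq (F * CR)) : teq s t -> tens_fun s = tens_fun t.
Proof.
move=> st; apply/val_inj/funext => q; apply: dual_separates => l.
have := congr1 (fun c : CR => c q) (dual_comp_tens s l).
by rewrite (eps_op_teq st) -dual_comp_tens.
Qed.

Definition tensor_fun (t : tensor F CR) : Cl ell D F := tens_fun (repr t).

Lemma tensor_fun_class s : tensor_fun (tclass s) = tens_fun s.
Proof. by apply: tens_fun_teq; apply/tclassP; rewrite tclassK. Qed.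

Lemma tensor_fun_linear : linear tensor_fun.
Proof.
move=> a t u.
rewrite -[a *: t + u]/(tclass (repr (tclass (tscale_seq a (repr t))) ++ repr u)).
rewrite tensor_fun_class /tens_fun big_cat /= -/(tens_fun _) -/(tensor_fun u).
rewrite -/(tensor_fun _) tensor_fun_class; congr (_ + _).
apply/val_inj/funext => q.
rewrite -[RHS]/(a *: tensor_fun t q) /tensor_fun [LHS]tens_funE tens_funE scaler_sumr big_map.
by apply: eq_bigr => p _ /=; rewrite !scalerA mulrC.
Qed.

Lemma tensor_fun_dense (c : Cl ell D F) (A : set (Cl ell D F)) : convex_set (dom D) ->
  nbhs c A -> exists t, A (tensor_fun t).
Proof.
move=> cD /Cl_ballP [L [K [U [cK U0 LA]]]].
have [s sL] := tens_dense cD c L cK U0.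
by exists (tclass s); apply: LA; rewrite tensor_fun_class.
Qed.

Lemma inj_tensor_cvgP (G : set_system (tensor F CR)) (t : tensor F CR) : Filter G ->
  G --> (t : inj_tensor F CR) <->
  forall (S : set (dual F)) (W : set CR), equicontinuous_set S -> nbhs 0 W ->
    G [set u | forall l, S l -> W (eps_op (repr u) l - eps_op (repr t) l)].
Proof.
move=> FG; split.
- move=> /initial_cvgP /initial_cvgP /fam_cvgP H S W eS W0.
  apply: (H S eS [set f : dual F -> CR | forall l, S l -> W (f l - eps_op (repr t) l)]).
  apply/uniform_nbhs; exists [set xy : CR * CR | W (xy.2 - xy.1)]; split => //.
  have : entourage [set xy : CR * CR | W (xy.1 - xy.2)].
    by rewrite lcs_entourageE; exists W.
  exact: entourage_inv.
- move=> H; apply/initial_cvgP/initial_cvgP/fam_cvgP => S eS B.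
  move=> /uniform_nbhs [V [/entourage_inv eV VB]].
  move: eV; rewrite lcs_entourageE => -[W W0 WV].
  apply: (@filterS _ G _ _ _ _ (H S W eS W0)) => u uW; apply: VB => l Sl.
  exact: (WV (eps_op (repr u) l, eps_op (repr t) l) (uW l Sl)).
Qed.

Lemma eps_op_repr0 l : eps_op (repr (0 : tensor F CR)) l = 0.
Proof.
have -> : eps_op (repr (0 : tensor F CR)) = eps_op [::].
  by apply: eps_op_teq; apply/tclassP; rewrite tclassK.
by rewrite /eps_op big_nil.
Qed.

Lemma Cl_partial_0 (E : lcsType R) al (p : dom D) : below ell al ->
  Cl_partial al (0 : Cl ell D E) p = 0.
Proof.
move=> b; have := congr1 (fun g => g p) (Cl_partial_lin (-1) (0 : Cl ell D E) 0 b).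
by rewrite !scaleN1r !addNr.
Qed.

(** A basic neighbourhood for [S] is matched with the vectors on which all of [S] is small, a
    0-neighbourhood by equicontinuity. Conversely, [lcs_polar] supplies [S] for a given [U], with
    the interval of radius 1 as scalar test set. *)
Lemma inj_tensor_nbhs0 (A : set (tensor F CR)) :
  nbhs (0 : inj_tensor F CR) A <->
  exists2 V : set (Cl ell D F), nbhs 0 V & tensor_fun @^-1` V `<=` A.
Proof.
split=> [A0|[V /Cl_ballP [L [K [U [cK U0 UV]]]] VA]].
- pose G := filter_from (nbhs (0 : Cl ell D F)) (fun V => tensor_fun @^-1` V).
  have FG : Filter G.
    apply: filter_from_filter; first by exists setT; exact: filterT.
    by move=> V W V0 W0; exists (V `&` W) => //; exact: filterI.
  suff : G --> (0 : inj_tensor F CR) by move=> /(_ A A0).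
  apply/inj_tensor_cvgP => S W eS /Cl_ballP [L [K [U [cK U0 UW]]]].
  have /nbhs_ballP [e /= e0 eU] : nbhs (0 : R) U := U0.
  have e2 : 0 < e / 2 by rewrite divr_gt0.
  have Ve := (equicontinuous_setP S).1 eS _ e2.
  exists (Cl_ball L K [set y | forall l, S l -> `|l y| <= e / 2] 0).
    exact: Cl_ball_nbhs.
  move=> t tV l Sl; rewrite eps_op_repr0 subr0; apply: UW => al p aL Kp.
  have b := svalP al; rewrite Cl_partial_0// subr0 -Cl_partial_dual//.
  apply: eU; rewrite -ball_normE /ball_ /= sub0r normrN.
  have := tV al p aL Kp l Sl; rewrite Cl_partial_0// subr0.
  by move=> /le_lt_trans; apply; rewrite ltr_pdivrMr// ltr_pMr// ltr1n.
- have [S eS SU] := lcs_polar U0.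
  have nW : nbhs (0 : CR) (Cl_ball L K [set x : R^o | `|x| <= 1] 0).
    apply: Cl_ball_nbhs => //; apply/nbhs_ballP; exists 1 => //= x.
    by rewrite -ball_normE /ball_ /= sub0r normrN => /ltW.
  have FN : Filter (nbhs (0 : inj_tensor F CR)) by exact: nbhs_filter.
  have N0 : nbhs (0 : inj_tensor F CR) --> (0 : inj_tensor F CR) by [].
  have /inj_tensor_cvgP H := N0.
  apply: filterS (H S _ eS nW) => t tW; apply: VA; apply: UV => al p aL Kp.
  have b := svalP al; rewrite Cl_partial_0// subr0; apply: SU => l Sl.
  rewrite Cl_partial_dual//; have := tW l Sl al p aL Kp.
  by rewrite eps_op_repr0 subr0 Cl_partial_0// subr0.
Qed.

End embedding.

Theorem proposition1p2 (R : realType) (F : lcsType R)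
  (F_complete : lcs_complete F) (ell : option nat) (d : nat)
  (d_gt0 : (0 < d)%N) (D : domain R d) (D_convex : convex_set (dom D))
  (G : lcsType R) (iota : {linear inj_tensor F (Cl ell D R^o) -> G}) :
  is_completion iota -> lcs_iso (Cl ell D F) G.
Proof.
move=> [G_complete _ iota_open iota_dense].
apply: (@completion_unique R (tensor F (Cl ell D R^o)) _ _ tensor_fun iota) => //.
- exact: tensor_fun_linear.
- by move=> a x y; exact: (linearP iota a x y).
- exact: Cl_complete.
- by move=> c A; exact: tensor_fun_dense.
- move=> c A cA; have : closure (range iota) c by rewrite iota_dense.
  by move=> /(_ A cA) [_ [[t _ <-] At]]; exists t.
- move=> W; rewrite nbhsE => -[B [oB B0] BW].
  have oA : open (iota @^-1` B) by apply/iota_open; exists B.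
  have /inj_tensor_nbhs0 [V V0 VB] : nbhs (0 : inj_tensor F (Cl ell D R^o)) (iota @^-1` B).
    by apply: open_nbhs_nbhs; split => //; rewrite /preimage /= linear0.
  by exists V => // t /VB /BW.
- move=> V V0.
  have : nbhs (0 : inj_tensor F (Cl ell D R^o)) (tensor_fun @^-1` V).
    by apply/inj_tensor_nbhs0; exists V.
  rewrite nbhsE => -[A [/iota_open [B oB BA] A0] AV]; exists B.
    apply: open_nbhs_nbhs; split => //.
    by move: A0; rewrite -BA /preimage /= linear0.
  by move=> t Bt; apply: AV; rewrite -BA.
Qed.
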